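(* Let $K$ be a field of characteristic $0$ and let $E=\bigsqcup_{n\ge1}E_n$ be a non-empty graded set with each $E_n$ finite. Let $I$ be the two-sided ideal of the free pre-Lie algebra $(\mathcal T^E,\to)$ generated by all elements $|s|(s\to t)+|t|(t\to s)$, $s,t\in T^E$. Then the set $\widetilde{\mathcal B}:=\{\Phi(t):t\in O(I)\}$ is a monomial basis for the free Lie algebra $(\mathcal L(E),[\cdot,\cdot])$.
   Context: $T^E$ is the set of non-planar rooted trees with vertices decorated by $E$, $\mathcal T^E$ its $K$-linear span. $E_n=\{a^n_1,\dots,a^n_{d_n}\}$ is the set of generators of degree $n$; the degree $|t|$ of a tree is the sum of the degrees of the decorations of its vertices. Grafting: $s\to t=\sum_{v\in V(t)}s\to_v t$, where $s\to_v t$ attaches the root of $s$ by a new edge to the vertex $v$ of $t$; $(\mathcal T^E,\to)$ is the free left pre-Lie algebra on the one-vertex trees. $\mathcal L(E)$ is the free Lie algebra over $K$ on $E$, graded by degree, with the pre-Lie product $x\rhd y=\frac1{|x|}[x,y]$ ($x$ homogeneous of degree $|x|$, extended bilinearly). $\Phi:(\mathcal T^E,\to)\to(\mathcal L(E),\rhd)$ is the unique pre-Lie homomorphism sending the one-vertex tree decorated by $a$ to $a$ for all $a\in E$. Generators are ordered by $a^1_1<\cdots<a^1_{d_1}<a^2_1<\cdots<a^2_{d_2}<\cdots$. Let $b(s)$ be the number of branches of $s$ at the root. The total order $\preceq$ on $T^E$ is defined recursively: $s\prec t$ iff (1) $|s|<|t|$; or (2) $|s|=|t|$ and $b(s)<b(t)$;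 or (3) $|s|=|t|$, $b(s)=b(t)=k$, and, listing the branches at the root in nondecreasing order $s_1\preceq\cdots\preceq s_k$, $t_1\preceq\cdots\preceq t_k$, there is $j\le k$ with $s_i=t_i$ for $i<j$ and $s_j\prec t_j$; or (4) $|s|=|t|$, $b(s)=b(t)$, $s_i=t_i$ for all $i$, and the root decoration of $s$ is strictly smaller than that of $t$. $\preceq$ means $\prec$ or $=$. For $0\neq f\in\mathcal T^E$, $T(f)$ is the $\preceq$-maximal tree occurring in $f$ with nonzero coefficient; $T(I)=\{T(f):0\ne f\in I\}$, $O(I)=T^E\setminus T(I)$. A monomial basis of the Lie algebra means a vector space basis each of whose elements is, up to a nonzero scalar, an iterated Lie bracket (with some bracketing) of generators from $E$. *)

(* Defs.v *)
From HB Require Import structures.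
From mathcomp Require Import all_boot all_order all_algebra finmap.
From mathcomp Require Import boolp classical_sets.
From mathcomp Require Import monalg.

Set Implicit Arguments.
Unset Strict Implicit.
Unset Printing Implicit Defensive.

Import GRing.Theory.
Local Open Scope ring_scope.
Local Open Scope quotient_scope.

(* Linear extension of h; locked because conversion otherwise unfolds it. *)
HB.lock Definition mext (K : fieldType) (X : choiceType) (V : lmodType K)
    (h : X -> V) (f : {malg K[X]}) : V :=
  \sum_(x <- msupp f) f@_x *: h x.

Section LinearExtension.
Variables (K : fieldType) (X : choiceType).

Lemma mext_def (V : lmodType K) (h : X -> V) (f : {malg K[X]}) :
  mext h f = \sum_(x <- msupp f) f@_x *: h x.
Proof. by rewrite mext.unlock. Qed.

Definition bext (op : X -> X -> {malg K[X]}) (f g : {malg K[X]}) :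
    {malg K[X]} :=
  mext (fun x => mext (fun y => op x y) g) f.

Lemma mextE (V : lmodType K) (h : X -> V) (f : {malg K[X]}) (A : {fset X}) :
  (msupp f `<=` A)%fset -> mext h f = \sum_(x <- A) f@_x *: h x.
Proof.
move=> sfA; rewrite mext_def (big_fset_incl _ sfA) //= => x _ /mcoeff_outdom ->.
by rewrite scale0r.
Qed.

Lemma mext_is_linear (V : lmodType K) (h : X -> V) : linear (mext h).
Proof.
move=> a f g.
pose A := (msupp f `|` msupp g)%fset.
have sA : (msupp (a *: f + g) `<=` A)%fset.
  apply: (fsubset_trans (msuppD_le _ _)).
  by apply: fsetSU; apply: msuppZ_le.
rewrite (mextE h sA) (mextE h (fsubsetUl _ (msupp g))).
rewrite (mextE h (fsubsetUr (msupp f) _)) scaler_sumr -big_split /=.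
by apply: eq_bigr => x _; rewrite mcoeffD mcoeffZ scalerDl scalerA.
Qed.

HB.instance Definition _ (V : lmodType K) (h : X -> V) :=
  GRing.isLinear.Build K {malg K[X]} V *:%R (mext h) (mext_is_linear h).

Lemma mextU (V : lmodType K) (h : X -> V) x : mext h << x >> = h x.
Proof.
by rewrite (mextE h msuppU_le) big_seq_fset1 mcoeffUU scale1r.
Qed.

Lemma malg_mext (f : {malg K[X]}) : f = mext (fun x => << x >>) f.
Proof.
rewrite {1}[f]monalgE mext_def; apply: eq_bigr => x _.
by apply/malgP => y; rewrite mcoeffZ !mcoeffU mulr_natr.
Qed.

Lemma malg_lin_ind (P : {malg K[X]} -> Prop) :
  P 0 -> (forall a f g, P f -> P g -> P (a *: f + g)) ->
  (forall x, P << x >>) -> forall f, P f.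
Proof.
move=> P0 PD PU f; rewrite [f]malg_mext mext_def.
apply: (big_ind P) => // [x y Px Py|x _].
  by have := PD 1 x y Px Py; rewrite scale1r.
by have := PD f@_x _ 0 (PU x) P0; rewrite addr0.
Qed.

Lemma mext_comp (V W : lmodType K) (u : {linear V -> W}) (h : X -> V) f :
  u (mext h f) = mext (u \o h) f.
Proof.
by rewrite !mext_def linear_sum; apply: eq_bigr => x _; rewrite linearZ.
Qed.

Lemma linear_mext (V : lmodType K) (u : {linear {malg K[X]} -> V}) f :
  u f = mext (fun x => u << x >>) f.
Proof. by rewrite {1}[f]malg_mext mext_comp. Qed.

Lemma bextDl op (h : {malg K[X]}) : linear (bext op ^~ h).
Proof. by move=> a f g; rewrite /bext linearP. Qed.

Lemma bextDr op (h : {malg K[X]}) : linear (bext op h).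
Proof.
move=> a f g; rewrite /bext !mext_def scaler_sumr -big_split /=.
apply: eq_bigr => x _; rewrite linearP scalerDr !scalerA.
by rewrite mulrC.
Qed.

HB.instance Definition _ op (h : {malg K[X]}) :=
  GRing.isLinear.Build K {malg K[X]} {malg K[X]} *:%R (bext op h)
    (bextDr op h).

Lemma bextUU op x y : bext op << x >> << y >> = op x y.
Proof. by rewrite /bext !mextU. Qed.

End LinearExtension.

Section NonassociativeAlgebra.
Variables (K : fieldType) (A : lmodType K).
Implicit Types (mul : A -> A -> A) (J S : set A).

Definition bilinear_op mul : Prop :=
  (forall z, linear (mul ^~ z)) /\ (forall z, linear (mul z)).

Definition two_sided_ideal mul J : Prop :=
  [/\ J 0,
      forall a x y, J x -> J y -> J (a *: x + y),
      forall x y, J y -> J (mul x y)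
    & forall x y, J x -> J (mul x y)].

Definition ideal_gen mul S : set A :=
  fun x => forall J, two_sided_ideal mul J -> (S `<=` J)%classic -> J x.

Definition lie_bracket mul : Prop :=
  [/\ bilinear_op mul,
      forall x, mul x x = 0
    & forall x y z,
        mul x (mul y z) + mul y (mul z x) + mul z (mul x y) = 0].

Definition lin_indep S : Prop :=
  forall (s : seq A) (c : A -> K), uniq s -> (forall x, x \in s -> S x) ->
    \sum_(x <- s) c x *: x = 0 -> forall x, x \in s -> c x = 0.

Definition spanning S : Prop :=
  forall v : A, exists (s : seq A) (c : A -> K),
    (forall x, x \in s -> S x) /\ v = \sum_(x <- s) c x *: x.

Definition vs_basis S : Prop := lin_indep S /\ spanning S.

Lemma ideal_gen_ideal mul S : two_sided_ideal mul (ideal_gen mul S).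
Proof.
split.
- by move=> J [].
- move=> a x y hx hy J iJ sJ; case: (iJ) => _ + _ _; apply.
    exact: hx.
  exact: hy.
- by move=> x y hy J iJ sJ; case: (iJ) => _ _ + _; apply; apply: hy.
- by move=> x y hx J iJ sJ; case: (iJ) => _ _ _; apply; apply: hx.
Qed.

Lemma ideal_gen_sub mul S : (S `<=` ideal_gen mul S)%classic.
Proof. by move=> x Sx J _; apply. Qed.

End NonassociativeAlgebra.

Section Generators.
Variable d : nat -> nat.

(* [d n] is the number of generators of degree [n.+1] (degrees start at 1):
   [Tagged _ i], with [i : 'I_(d n)], stands for the generator a^{n+1}_{i+1}. *)
Definition gen : Type := {n : nat & 'I_(d n)}.
HB.instance Definition _ := Countable.on gen.

Definition gdeg (a : gen) : nat := (tag a).+1.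

Definition glt (a b : gen) : bool :=
  (gdeg a < gdeg b)%N ||
  (gdeg a == gdeg b) && (val (tagged a) < val (tagged b))%N.

Inductive ptree : Type := PNode of gen & seq ptree.

Fixpoint ptree_rect' (P : ptree -> Prop)
  (H : forall a ts, foldr (fun t Q => P t /\ Q) True ts -> P (PNode a ts))
  (t : ptree) : P t :=
  let: PNode a ts := t in
  H a ts ((fix F l : foldr (fun t Q => P t /\ Q) True l :=
    if l is u :: l' then conj (ptree_rect' H u) (F l') else I) ts).

HB.instance Definition _ := gen_eqMixin ptree.
HB.instance Definition _ := gen_choiceMixin ptree.

Lemma ptree_ind_in (P : ptree -> Prop) :
  (forall a ts, (forall t, t \in ts -> P t) -> P (PNode a ts)) ->
  forall t, P t.
Proof.
move=> H; elim/ptree_rect' => a ts IH; apply: H => t.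
elim: ts IH => //= u ts IHu [Pu /IHu IH']; rewrite inE => /orP[/eqP->//|].
exact: IH'.
Qed.

Fixpoint pdeg (t : ptree) : nat :=
  let: PNode a ts := t in (gdeg a + sumn (map pdeg ts))%N.

Section Lexicographic.
Variable lt : rel ptree.

Fixpoint lexlt (us vs : seq ptree) : bool :=
  match us, vs with
  | u :: us', v :: vs' => lt u v || (u == v) && lexlt us' vs'
  | _, _ => false
  end.

End Lexicographic.

(* Compares the degree, then the number of branches at the root, then the
   branches lexicographically in the listed order, then the root decoration. On
   trees satisfying [canonical] the listed order is the nondecreasing one. *)
Fixpoint ptlt (s t : ptree) {struct s} : bool :=
  let: PNode a ss := s in
  let: PNode b ts := t in
  (pdeg s < pdeg t)%N ||
  (pdeg s == pdeg t) &&
    ((size ss < size ts)%N ||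
     (size ss == size ts) && (lexlt ptlt ss ts || (ss == ts) && glt a b)).

Definition ptle (s t : ptree) : bool := (s == t) || ptlt s t.

(* The list of the trees s ->_v t, with v running over the vertices of t: the
   root first, then the vertices of each branch. *)
Fixpoint grafts (s t : ptree) : seq ptree :=
  let: PNode a ts := t in
  let fix in_branch us :=
    if us is u :: us' then
      [seq u' :: us' | u' <- grafts s u] ++ [seq u :: vs | vs <- in_branch us']
    else [::] in
  PNode a (s :: ts) :: [seq PNode a us | us <- in_branch ts].

(* A non-planar rooted tree is a planar one up to permutation of the branches
   at each vertex ([same_tree]). Each class has exactly one representative all
   of whose branch lists are nondecreasing ([normalizeP], [normalize_canonical],
   [normalize_id] and [same_normalize]); non-planar
   trees are encoded by these representatives. *)
Inductive same_tree : ptree -> ptree -> Prop :=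
| same_refl t : same_tree t t
| same_sym s t : same_tree s t -> same_tree t s
| same_trans s t u : same_tree s t -> same_tree t u -> same_tree s u
| same_perm a ss ts : perm_eq ss ts -> same_tree (PNode a ss) (PNode a ts)
| same_branch a s t us :
    same_tree s t -> same_tree (PNode a (s :: us)) (PNode a (t :: us)).

Fixpoint canonical (t : ptree) : bool :=
  let: PNode _ ts := t in sorted ptle ts && all canonical ts.

Fixpoint normalize (t : ptree) : ptree :=
  let: PNode a ts := t in PNode a (sort ptle (map normalize ts)).

Lemma glt_irr a : glt a a = false.
Proof. by rewrite /glt !ltnn andbF. Qed.

Lemma glt_trans : transitive glt.
Proof.
move=> b a c; rewrite /glt => /orP[ab|/andP[/eqP ab iab]].
  case/orP=> [bc|/andP[/eqP <- _]]; last by rewrite ab.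
  by rewrite (ltn_trans ab bc).
case/orP=> [bc|/andP[/eqP <- ibc]]; first by rewrite ab bc.
by rewrite ab eqxx (ltn_trans iab ibc) orbT.
Qed.

Lemma glt_total a b : [|| a == b, glt a b | glt b a].
Proof.
rewrite /glt /gdeg !ltnS !eqSS; case: a b => [m i] [n j] /=.
case: (ltngtP m n) => [||e]; rewrite ?orbT //.
case: _ / e j => j /=; case: (ltngtP (i : nat) j) => [||e]; rewrite ?orbT //.
by rewrite (val_inj e) eqxx.
Qed.

Lemma ptltE a ss b ts : ptlt (PNode a ss) (PNode b ts) =
  (pdeg (PNode a ss) < pdeg (PNode b ts))%N ||
  (pdeg (PNode a ss) == pdeg (PNode b ts)) &&
    ((size ss < size ts)%N ||
     (size ss == size ts) && (lexlt ptlt ss ts || (ss == ts) && glt a b)).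
Proof. by []. Qed.

Lemma ptlt_irr t : ptlt t t = false.
Proof.
elim/ptree_ind_in: t => a ts IH; rewrite ptltE !ltnn !eqxx glt_irr /= orbF.
elim: ts IH => //= t ts IHt IH; rewrite IH ?mem_head //= eqxx /=.
by apply: IHt => u u_ts; rewrite IH // inE u_ts orbT.
Qed.

Lemma ptlt_trans : transitive ptlt.
Proof.
move=> t s u; elim/ptree_ind_in: s t u => a ss IH [b ts] [c us].
rewrite !ptltE.
have lex_trans : lexlt ptlt ss ts -> lexlt ptlt ts us -> lexlt ptlt ss us.
  elim: ss IH ts us => //= s ss IHs IH [//|t ts] [//|u us].
  have tr := IH s (mem_head _ _).
  case/orP=> [st|/andP[/eqP <- lst]]; case/orP=> [tu|/andP[/eqP <- ltu]].
  - by rewrite (tr _ _ st tu).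
  - by rewrite st.
  - by rewrite tu.
  - rewrite eqxx (IHs _ ts us) ?orbT // => v v_ss; apply: IH.
    by rewrite inE v_ss orbT.
case/orP=> [d1|/andP[/eqP d1 H1]].
  case/orP=> [d2|/andP[/eqP <- _]]; last by rewrite d1.
  by rewrite (ltn_trans d1 d2).
case/orP=> [d2|/andP[/eqP d2 H2]]; first by rewrite d1 d2.
rewrite d1 d2 eqxx ltnn /=.
case/orP: H1 => [b1|/andP[/eqP b1 H1]].
  case/orP: H2 => [b2|/andP[/eqP <- _]]; last by rewrite b1.
  by rewrite (ltn_trans b1 b2).
case/orP: H2 => [b2|/andP[/eqP b2 H2]]; first by rewrite b1 b2.
rewrite b1 b2 eqxx ltnn /=.
case/orP: H1 => [l1|/andP[/eqP e1 g1]].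
  case/orP: H2 => [l2|/andP[/eqP <- _]]; last by rewrite l1.
  by rewrite lex_trans.
case/orP: H2 => [l2|/andP[/eqP e2 g2]]; first by rewrite e1 l2.
by rewrite e1 e2 eqxx (glt_trans g1 g2) orbT.
Qed.

Lemma ptlt_total s t : [|| s == t, ptlt s t | ptlt t s].
Proof.
elim/ptree_ind_in: s t => a ss IH [b ts]; rewrite !ptltE.
case: ltngtP => //= _; rewrite ?orbT //.
case: ltngtP => //= eqsz; rewrite ?orbT //.
have : [|| ss == ts, lexlt ptlt ss ts | lexlt ptlt ts ss].
  elim: ss IH ts eqsz => [|s ss IHs] IH [|t ts] //= [eqsz].
  have := IH s (mem_head _ _) t; rewrite eqseq_cons [t == s]eq_sym.
  have [<- _|_] /= := eqVneq s t; last by case/orP=> ->; rewrite ?orbT.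
  rewrite ptlt_irr /=; apply: IHs => // v v_ss; apply: IH.
  by rewrite inE v_ss orbT.
case/or3P=> [/eqP<-|->|->]; rewrite ?orbT // eqxx /=.
case/or3P: (glt_total a b) => [/eqP<-|->|->]; rewrite ?orbT //.
by rewrite eqxx.
Qed.

Lemma ptle_total : total ptle.
Proof.
move=> s t; rewrite /ptle; case/or3P: (ptlt_total s t) => [/eqP->|->|->].
- by rewrite eqxx.
- by rewrite orbT.
- by rewrite !orbT.
Qed.

Lemma ptle_trans : transitive ptle.
Proof.
move=> t s u /orP[/eqP->//|st] /orP[/eqP<-|tu]; rewrite /ptle ?st ?orbT //.
by rewrite (ptlt_trans st tu) orbT.
Qed.

Lemma ptle_anti : antisymmetric ptle.
Proof.
move=> s t /andP[/orP[/eqP//|st] /orP[/eqP//|ts]].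
by have := ptlt_trans st ts; rewrite ptlt_irr.
Qed.

Lemma normalize_canonical t : canonical (normalize t).
Proof.
elim/ptree_ind_in: t => a ts IH /=; rewrite (sort_sorted ptle_total) /=.
by rewrite all_sort all_map; apply/allP => t /IH.
Qed.

Lemma normalize_id t : canonical t -> normalize t = t.
Proof.
elim/ptree_ind_in: t => a ts IH /= /andP[so /allP can]; congr PNode.
have -> : map normalize ts = ts.
  by rewrite -[RHS]map_id; apply/eq_in_map => t t_ts; rewrite IH ?can.
exact: (sorted_sort ptle_trans).
Qed.

Lemma same_normalize t : same_tree t (normalize t).
Proof.
elim/ptree_ind_in: t => a ts IH /=.
apply: (@same_trans _ (PNode a (map normalize ts))); last first.
  by apply: same_perm; rewrite perm_sym perm_sort.
suff H us : same_tree (PNode a (us ++ ts)) (PNode a (us ++ map normalize ts)).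
  exact: (H [::]).
elim: ts IH us => [|t ts IHt] IH us /=; first exact: same_refl.
apply: (@same_trans _ (PNode a (us ++ normalize t :: ts))); last first.
  rewrite -!cat_rcons; apply: IHt => u u_ts; apply: IH.
  by rewrite inE u_ts orbT.
apply: (@same_trans _ (PNode a (t :: us ++ ts))).
  by apply: same_perm; rewrite perm_catC /= perm_cons perm_catC.
apply: (@same_trans _ (PNode a (normalize t :: us ++ ts))).
  by apply: same_branch; apply: IH; rewrite mem_head.
by apply: same_perm; rewrite perm_sym perm_catC /= perm_cons perm_catC.
Qed.

Lemma normalizeP s t : same_tree s t <-> normalize s = normalize t.
Proof.
split=> [|e].
  elim=> {s t} [//|s t _ -> //|s t u _ -> _ -> //|a ss ts p|a s t us _ e] /=.
    congr PNode; apply/(perm_sortP ptle_total ptle_trans ptle_anti).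
    exact: perm_map.
  by rewrite e.
apply: (@same_trans _ (normalize s)); first exact: same_normalize.
by rewrite e; apply: same_sym; apply: same_normalize.
Qed.

Definition tree : Type := {t : ptree | canonical t}.
HB.instance Definition _ := SubChoice.on tree.

Definition mktree (t : ptree) : tree :=
  exist (fun u => canonical u) (normalize t) (normalize_canonical t).
Definition vertex (a : gen) : tree := mktree (PNode a [::]).
Definition tdeg (t : tree) : nat := pdeg (val t).
Definition tle (s t : tree) : bool := ptle (val s) (val t).

Inductive magma : Type := Gen of gen | Br of magma & magma.

HB.instance Definition _ := gen_eqMixin magma.
HB.instance Definition _ := gen_choiceMixin magma.

Fixpoint mdeg (w : magma) : nat :=
  match w with Gen a => gdeg a | Br u v => (mdeg u + mdeg v)%N end.

Lemma mdeg_gt0 w : (0 < mdeg w)%N.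
Proof. by elim: w => //= u lu v lv; rewrite addn_gt0 lu. Qed.

End Generators.

Section TreeAlgebra.
Variables (K : fieldType) (d : nat -> nat).

Definition treeAlg : Type := {malg K[tree d]}.
HB.instance Definition _ := GRing.Lmodule.on treeAlg.

Definition graft_tree (s t : tree d) : treeAlg :=
  \sum_(u <- grafts (val s) (val t)) << mktree u >>.

Definition graft : treeAlg -> treeAlg -> treeAlg := bext graft_tree.

Definition I_gens : set treeAlg :=
  fun f => exists s t : tree d,
    f = (tdeg s)%:R *: graft << s >> << t >>
        + (tdeg t)%:R *: graft << t >> << s >>.

Definition I_ideal : set treeAlg := ideal_gen graft I_gens.

Definition is_leading (f : treeAlg) (t : tree d) : Prop :=
  t \in msupp f /\ forall u, u \in msupp f -> tle u t.

Definition T_set (J : set treeAlg) : set (tree d) :=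
  fun t => exists f, [/\ J f, f != 0 & is_leading f t].

Definition O_set (J : set treeAlg) : set (tree d) := (~` T_set J)%classic.

End TreeAlgebra.

Arguments I_ideal K d : clear implicits.

Section FreeLie.
Variables (K : fieldType) (d : nat -> nat).

Definition magmaAlg : Type := {malg K[magma d]}.
HB.instance Definition _ := GRing.Lmodule.on magmaAlg.

Definition magma_mul : magmaAlg -> magmaAlg -> magmaAlg :=
  bext (fun u v => << Br u v >>).

Definition lie_relators : set magmaAlg :=
  fun f => (exists x, f = magma_mul x x) \/
    exists x y z, f = magma_mul x (magma_mul y z)
                      + magma_mul y (magma_mul z x)
                      + magma_mul z (magma_mul x y).

Definition lie_ideal : set magmaAlg := ideal_gen magma_mul lie_relators.

Definition lie_idealb (f : magmaAlg) : bool := `[< lie_ideal f >].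

Lemma lie_ideal_ideal : two_sided_ideal magma_mul lie_ideal.
Proof. exact: ideal_gen_ideal. Qed.

Lemma lie_idealb_zmod : zmod_closed lie_idealb.
Proof.
have [J0 JD _ _] := lie_ideal_ideal.
split=> [|x y]; rewrite !unfold_in; first exact/asboolP.
move=> /asboolP Jx /asboolP Jy; apply/asboolP.
by rewrite addrC -scaleN1r; apply: JD.
Qed.

HB.instance Definition _ :=
  GRing.isZmodClosed.Build magmaAlg lie_idealb lie_idealb_zmod.

Definition lie_zmodClosed : zmodClosed magmaAlg :=
  GRing.ZmodClosed.clone magmaAlg lie_idealb _.

Definition freeLie : Type := Quotient.quot lie_zmodClosed.
HB.instance Definition _ := GRing.Zmodule.on freeLie.
HB.instance Definition _ := EqQuotient.on freeLie.

Definition lpi (f : magmaAlg) : freeLie := \pi_freeLie f.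

Lemma lpi_eq f g : lpi f = lpi g <-> lie_ideal (f - g).
Proof.
have h := Quotient.idealrBE lie_zmodClosed f g.
split=> [/eqP e|/asboolP Jfg].
  by apply/asboolP; have : f - g \in lie_zmodClosed by rewrite h.
by have : f - g \in lie_zmodClosed by []; rewrite h => /eqP.
Qed.

Lemma lreprK x : lpi (repr x) = x.
Proof. exact: reprK. Qed.

Lemma lpiD f g : lpi (f + g) = lpi f + lpi g.
Proof. exact: (Quotient.pi_add lie_zmodClosed). Qed.

Lemma lrepr_lpi f : lie_ideal (repr (lpi f) - f).
Proof. by apply/lpi_eq; rewrite lreprK. Qed.

Let J0 : lie_ideal 0. Proof. by case: lie_ideal_ideal. Qed.
Let JP a f g : lie_ideal f -> lie_ideal g -> lie_ideal (a *: f + g).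
Proof. by case: lie_ideal_ideal => _ + _ _; apply. Qed.
Let JZ a f : lie_ideal f -> lie_ideal (a *: f).
Proof. by move=> Jf; rewrite -[_ *: _]addr0; apply: JP. Qed.
Let JD f g : lie_ideal f -> lie_ideal g -> lie_ideal (f + g).
Proof. by move=> Jf; rewrite -[f]scale1r; apply: JP. Qed.
Let JB f g : lie_ideal f -> lie_ideal g -> lie_ideal (f - g).
Proof. by move=> Jf Jg; rewrite -scaleN1r; apply: JD => //; apply: JZ. Qed.
Let JMr f g : lie_ideal g -> lie_ideal (magma_mul f g).
Proof. by case: lie_ideal_ideal => _ _ + _; apply. Qed.
Let JMl f g : lie_ideal f -> lie_ideal (magma_mul f g).
Proof. by case: lie_ideal_ideal => _ _ _; apply. Qed.

Definition lscale (a : K) (x : freeLie) : freeLie := lpi (a *: repr x).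

Lemma lpi_scale a f : lscale a (lpi f) = lpi (a *: f).
Proof. by apply/lpi_eq; rewrite -scalerBr; apply: JZ; apply: lrepr_lpi. Qed.

Lemma lscaleA a b x : lscale a (lscale b x) = lscale (a * b) x.
Proof. by rewrite -[x]lreprK !lpi_scale scalerA. Qed.

Lemma lscale1 : left_id 1 lscale.
Proof. by move=> x; rewrite -[x]lreprK !lpi_scale scale1r. Qed.

Lemma lscaleDr : right_distributive lscale +%R.
Proof.
by move=> a x y; rewrite -[x]lreprK -[y]lreprK !(lpi_scale, =^~ lpiD) scalerDr.
Qed.

Lemma lscaleDl x : {morph lscale^~ x : a b / a + b}.
Proof.
by move=> a b; rewrite -[x]lreprK /= !(lpi_scale, =^~ lpiD) scalerDl.
Qed.

HB.instance Definition _ :=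
  GRing.Zmodule_isLmodule.Build K freeLie lscaleA lscale1 lscaleDr lscaleDl.

Lemma lpiZ a f : lpi (a *: f) = a *: lpi f.
Proof. by rewrite -lpi_scale. Qed.

Lemma lpi_is_linear : linear lpi.
Proof. by move=> a f g; rewrite lpiD lpiZ. Qed.

HB.instance Definition _ :=
  GRing.isLinear.Build K magmaAlg freeLie *:%R lpi lpi_is_linear.

Definition lbr (x y : freeLie) : freeLie := lpi (magma_mul (repr x) (repr y)).

Definition lgen (a : gen d) : freeLie := lpi << Gen a >>.

Lemma magma_mulP f : linear (magma_mul f).
Proof. exact: bextDr. Qed.

Lemma magma_mulPl f : linear (magma_mul ^~ f).
Proof. exact: bextDl. Qed.

HB.instance Definition _ f :=
  GRing.isLinear.Build K magmaAlg magmaAlg *:%R (magma_mul f) (magma_mulP f).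

Lemma magma_mulDl f g h :
  magma_mul (f + g) h = magma_mul f h + magma_mul g h.
Proof. by have := magma_mulPl h 1 f g; rewrite !scale1r. Qed.

Lemma magma_mul0l h : magma_mul 0 h = 0.
Proof.
by have := magma_mulPl h (-1) 0 0; rewrite !scaleN1r oppr0 addr0 addNr.
Qed.

Lemma magma_mulZl a f h : magma_mul (a *: f) h = a *: magma_mul f h.
Proof. by have := magma_mulPl h a f 0; rewrite magma_mul0l !addr0. Qed.

Lemma magma_mulBl f g h :
  magma_mul (f - g) h = magma_mul f h - magma_mul g h.
Proof. by rewrite -scaleN1r magma_mulDl magma_mulZl scaleN1r. Qed.

Lemma lbr_lpi f g : lbr (lpi f) (lpi g) = lpi (magma_mul f g).
Proof.
apply/lpi_eq.
have -> : magma_mul (repr (lpi f)) (repr (lpi g)) - magma_mul f g =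
  magma_mul (repr (lpi f) - f) (repr (lpi g))
  + magma_mul f (repr (lpi g) - g).
  by rewrite magma_mulBl linearB /= addrA subrK.
by apply: JD; [apply: JMl | apply: JMr]; apply: lrepr_lpi.
Qed.

Lemma lbr_lie : lie_bracket lbr.
Proof.
split; first split.
- move=> z a x y; rewrite -[x]lreprK -[y]lreprK -[z]lreprK.
  by rewrite /= -lpiZ -lpiD !lbr_lpi -lpiZ -lpiD; congr lpi; apply: magma_mulPl.
- move=> z a x y; rewrite -[x]lreprK -[y]lreprK -[z]lreprK.
  by rewrite /= -lpiZ -lpiD !lbr_lpi -lpiZ -lpiD; congr lpi; apply: magma_mulP.
- move=> x; rewrite -[x]lreprK lbr_lpi -(linear0 lpi); apply/lpi_eq.
  by rewrite subr0; apply: ideal_gen_sub; left; exists (repr x).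
move=> x y z; rewrite -[x]lreprK -[y]lreprK -[z]lreprK !lbr_lpi -!linearD.
rewrite -(linear0 lpi); apply/lpi_eq; rewrite subr0; apply: ideal_gen_sub.
by right; exists (repr x), (repr y), (repr z).
Qed.

Lemma freeLie_universal (V : lmodType K) (b : V -> V -> V) (h : gen d -> V) :
  lie_bracket b ->
  exists u : {linear freeLie -> V},
    [/\ forall x y, u (lbr x y) = b (u x) (u y),
        forall a, u (lgen a) = h a
      & forall u' : {linear freeLie -> V},
          (forall x y, u' (lbr x y) = b (u' x) (u' y)) ->
          (forall a, u' (lgen a) = h a) -> u' =1 u].
Proof.
move=> [[bl br] bxx bJ].
pose ev := fix ev w :=
  match w with Gen a => h a | Br w1 w2 => b (ev w1) (ev w2) end.
pose U : magmaAlg -> V := mext ev.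
have UP a f g : U (a *: f + g) = a *: U f + U g by exact: linearP.
have U0 : U 0 = 0 by exact: linear0.
have bl0 z : b 0 z = 0.
  by have := bl z (-1) 0 0; rewrite !scaleN1r oppr0 addr0 addNr.
have br0 z : b z 0 = 0.
  by have := br z (-1) 0 0; rewrite !scaleN1r oppr0 addr0 addNr.
have UM f g : U (magma_mul f g) = b (U f) (U g).
  elim/malg_lin_ind: f => [|a f1 f2 IH1 IH2|u].
  - by rewrite magma_mul0l U0 bl0.
  - by rewrite magma_mulDl magma_mulZl !UP IH1 IH2 bl.
  elim/malg_lin_ind: g => [|a g1 g2 IH1 IH2|v].
  - by rewrite linear0 U0 br0.
  - by rewrite linearP !UP IH1 IH2 br.
  by rewrite /magma_mul bextUU /U !mextU.
have UJ f : lie_ideal f -> U f = 0.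
  move=> Jf; apply: (Jf (fun f => U f = 0)); first split=> //.
  - by move=> a f1 f2 e1 e2; rewrite UP e1 e2 scaler0 addr0.
  - by move=> f1 f2 e; rewrite UM e br0.
  - by move=> f1 f2 e; rewrite UM e bl0.
  have UD f1 f2 : U (f1 + f2) = U f1 + U f2 by exact: linearD.
  by move=> _ [[x ->]|[x [y [z ->]]]]; rewrite ?UD !UM ?bxx ?bJ.
pose u (x : freeLie) := U (repr x).
have upi f : u (lpi f) = U f.
  have := UJ _ (lrepr_lpi f); rewrite /U linearB /= => /eqP.
  by rewrite subr_eq0 => /eqP.
have u_lin : linear u.
  move=> a x y; rewrite -[x]lreprK -[y]lreprK -lpiZ -lpiD !upi.
  exact: UP.
pose uL := GRing.isLinear.Build K freeLie V *:%R u u_lin.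
pose u1 : {linear freeLie -> V} := HB.pack u uL.
exists u1; split=> [x y|a|u' u'br u'gen x].
- by rewrite /= -[x]lreprK -[y]lreprK lbr_lpi !upi UM.
- by rewrite /= upi /U mextU.
rewrite /= -[x]lreprK upi; elim/malg_lin_ind: (repr x) => [|a f g IH1 IH2|w].
- by rewrite !linear0.
- by rewrite !linearP IH1 IH2.
rewrite /U mextU; elim: w => [a|w1 IH1 w2 IH2] /=; first exact: u'gen.
by rewrite -IH1 -IH2 -u'br lbr_lpi /magma_mul bextUU.
Qed.

Definition homogeneous (n : nat) (x : freeLie) : Prop :=
  exists2 f : magmaAlg, x = lpi f & forall w, w \in msupp f -> mdeg w = n.

(* Divides the component of degree n by n, for every n. This does not depend on
   the representative ([ldivdeg_lpi]), and [rhd] is the bilinear operation with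
   x |> y = 1/|x| [x, y] for homogeneous x ([rhd_homogeneous]). *)
Definition magma_divdeg : magmaAlg -> magmaAlg :=
  mext (fun w => (mdeg w)%:R^-1 *: << w >>).

Definition ldivdeg (x : freeLie) : freeLie := lpi (magma_divdeg (repr x)).

Definition rhd (x y : freeLie) : freeLie := lbr (ldivdeg x) y.

Fixpoint lmonomial (w : magma d) : freeLie :=
  match w with
  | Gen a => lgen a
  | Br u v => lbr (lmonomial u) (lmonomial v)
  end.

Definition monomial_basis (B : set freeLie) : Prop :=
  vs_basis B /\
  forall x, B x -> exists (c : K) (w : magma d),
    c != 0 /\ x = c *: lmonomial w.

Section Homogeneity.
Hypothesis K0 : [pchar K] =i pred0.

Let dmap (phi : nat -> K) : magmaAlg -> magmaAlg :=
  mext (fun w => phi (mdeg w) *: << w >>).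

Let dmapP phi a f g : dmap phi (a *: f + g) = a *: dmap phi f + dmap phi g.
Proof. exact: linearP. Qed.

Let dmap0 phi : dmap phi 0 = 0. Proof. exact: linear0. Qed.

Let dmapD phi f g : dmap phi (f + g) = dmap phi f + dmap phi g.
Proof. exact: linearD. Qed.

Let dmapU phi w : dmap phi << w >> = phi (mdeg w) *: << w >>.
Proof. exact: mextU. Qed.

Let mulUU u v : magma_mul << u >> << v >> = << Br u v >>.
Proof. exact: bextUU. Qed.

Let shift (phi : nat -> K) m := fun n => phi (m + n)%N.

Let dmapMr phi u g :
  dmap phi (magma_mul << u >> g) = magma_mul << u >> (dmap (shift phi (mdeg u)) g).
Proof.
elim/malg_lin_ind: g => [|a f g IH1 IH2|v]; first by rewrite !dmap0 !linear0 dmap0.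
  by rewrite linearP !dmapP IH1 IH2 linearP.
by rewrite mulUU !dmapU linearZ /= mulUU.
Qed.

Let dmapMl phi u g :
  dmap phi (magma_mul g << u >>) = magma_mul (dmap (shift phi (mdeg u)) g) << u >>.
Proof.
elim/malg_lin_ind: g => [|a f g IH1 IH2|v].
- by rewrite dmap0 !magma_mul0l dmap0.
- by rewrite magma_mulDl magma_mulZl !dmapP IH1 IH2 magma_mulDl magma_mulZl.
by rewrite mulUU !dmapU magma_mulZl mulUU /shift /= addnC.
Qed.

Let J_anti f g : lie_ideal (magma_mul f g + magma_mul g f).
Proof.
have Jxx x : lie_ideal (magma_mul x x).
  by apply: ideal_gen_sub; left; exists x.
have -> : magma_mul f g + magma_mul g f =
    magma_mul (f + g) (f + g) - magma_mul f f - magma_mul g g.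
  have h (p q r s : magmaAlg) : q + r = p + q + (r + s) - p - s.
    by rewrite -(addrA p) [p + _]addrC addrK addrA addrK.
  by rewrite !magma_mulDl !linearD /= -h.
by apply: JB; [apply: JB|].
Qed.

Let J_dmap_anti phi f g :
  lie_ideal (dmap phi (magma_mul f g + magma_mul g f)).
Proof.
elim/malg_lin_ind: f => [|a f1 f2 IH1 IH2|u].
- by rewrite magma_mul0l linear0 addr0 dmap0.
- rewrite magma_mulDl magma_mulZl linearP addrACA -scalerDr dmapP.
  exact: JP.
elim/malg_lin_ind: g => [|a f1 f2 IH1 IH2|v].
- by rewrite magma_mul0l linear0 addr0 dmap0.
- rewrite magma_mulDl magma_mulZl linearP addrACA -scalerDr dmapP.
  exact: JP.
rewrite !mulUU dmapD !dmapU /= [(mdeg v + _)%N]addnC -scalerDr -!mulUU.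
by apply: JZ; apply: J_anti.
Qed.

Let jac f g h := magma_mul f (magma_mul g h) + magma_mul g (magma_mul h f)
                 + magma_mul h (magma_mul f g).

Let jac_rot f g h : jac f g h = jac g h f.
Proof. by rewrite /jac -addrA addrC. Qed.

Let jacP a f f' g h : jac (a *: f + f') g h = a *: jac f g h + jac f' g h.
Proof.
rewrite /jac !magma_mulDl !magma_mulZl !linearP /= !scalerDr.
have h6 (p p' q q' r r' : magmaAlg) :
    p + p' + (q + q') + (r + r') = p + q + r + (p' + q' + r').
  by rewrite (addrACA p) (addrACA (p + q)).
exact: h6.
Qed.

Let jac0 g h : jac 0 g h = 0.
Proof. by rewrite /jac !magma_mul0l !linear0 !addr0. Qed.

Let J_dmap_jac phi f g h : lie_ideal (dmap phi (jac f g h)).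
Proof.
elim/malg_lin_ind: f => [|a f1 f2 IH1 IH2|u]; first by rewrite jac0 dmap0.
  by rewrite jacP dmapP; apply: JP.
rewrite jac_rot; elim/malg_lin_ind: g => [|a f1 f2 IH1 IH2|v].
- by rewrite jac0 dmap0.
- by rewrite jacP dmapP; apply: JP.
rewrite jac_rot; elim/malg_lin_ind: h => [|a f1 f2 IH1 IH2|w].
- by rewrite jac0 dmap0.
- by rewrite jacP dmapP; apply: JP.
rewrite {1}/jac !mulUU !dmapD !dmapU /=.
have e1 : (mdeg u + (mdeg v + mdeg w) = mdeg w + (mdeg u + mdeg v))%N.
  by rewrite addnA addnC.
have e2 : (mdeg v + (mdeg w + mdeg u) = mdeg w + (mdeg u + mdeg v))%N.
  by rewrite addnCA [(mdeg v + _)%N]addnC.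
rewrite e1 e2 -!scalerDr -!mulUU; apply: JZ; apply: ideal_gen_sub; right.
by exists << w >>, << u >>, << v >>.
Qed.

Lemma lie_ideal_dmap (phi : nat -> K) f :
  lie_ideal f ->
  lie_ideal (mext (fun w => phi (mdeg w) *: << w >> : magmaAlg) f).
Proof.
rewrite -/(dmap phi f) => Jf; move: phi.
apply: (Jf (fun f => forall phi, lie_ideal (dmap phi f))).
  split=> [phi|a x y Jx Jy phi|x y Jy phi|x y Jx phi].
  - by rewrite dmap0.
  - by rewrite dmapP; apply: JP.
  - elim/malg_lin_ind: x => [|a x1 x2 IH1 IH2|u].
    + by rewrite magma_mul0l dmap0.
    + by rewrite magma_mulDl magma_mulZl dmapP; apply: JP.
    by rewrite dmapMr; apply: JMr.
  elim/malg_lin_ind: y => [|a x1 x2 IH1 IH2|u].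
  + by rewrite linear0 dmap0.
  + by rewrite linearP dmapP; apply: JP.
  by rewrite dmapMl; apply: JMl.
move=> _ [[x ->]|[x [y [z ->]]]] phi; last exact: J_dmap_jac.
have two : (2%:R : K) != 0.
  by have := K0 2; rewrite !inE /= => ->.
have := JZ 2%:R^-1 (J_dmap_anti phi x x).
by rewrite dmapD -mulr2n -scaler_nat scalerA mulVf // scale1r.
Qed.

Lemma ldivdeg_lpi f : ldivdeg (lpi f) = lpi (magma_divdeg f).
Proof.
apply/lpi_eq; rewrite /magma_divdeg -linearB.
exact: (lie_ideal_dmap (fun n => n%:R^-1) (lrepr_lpi f)).
Qed.

Lemma rhd_bilinear : bilinear_op rhd.
Proof.
have [[bl br] _ _] := lbr_lie.
split=> z a x y; last exact: br.
rewrite /rhd -bl; congr (lbr _ z).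
rewrite -[x]lreprK -[y]lreprK -lpiZ -lpiD !ldivdeg_lpi -lpiZ -lpiD.
congr lpi.
exact: linearP.
Qed.

Lemma rhd_homogeneous n x y :
  homogeneous n x -> rhd x y = n%:R^-1 *: lbr x y.
Proof.
move=> [f -> degf]; rewrite /rhd ldivdeg_lpi -[y]lreprK !lbr_lpi -linearZ.
congr lpi; rewrite -magma_mulZl; congr magma_mul.
rewrite {2}[f]malg_mext /magma_divdeg !mext_def scaler_sumr.
rewrite big_seq [RHS]big_seq; apply: eq_bigr => w /degf ->.
by rewrite !scalerA mulrC.
Qed.

End Homogeneity.

End FreeLie.

(* Main.v *)
From HB Require Import structures.
Require Import Defs.
From Stdlib Require Import Wellfounded.
From mathcomp Require Import all_boot all_order all_algebra finmap.
From mathcomp Require Import boolp classical_sets.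
From mathcomp Require Import monalg.

(** Three facts give the theorem: [Phi] is onto with kernel I, the trees of
    O(I) form a basis of a complement of I, and each of them is mapped to a
    scalar multiple of a bracket of generators.

    Kernel. The image of a tree is homogeneous of its degree, so
    Phi (s -> t) = |s|^-1 [Phi s, Phi t], and Phi kills the generators of I
    because the Lie bracket is antisymmetric. For the converse, consider the
    bracket |s| (s -> t) on trees. Modulo I it is antisymmetric by the very
    choice of the generators of I, and the pre-Lie identity ([graft_prelie])
    then yields Jacobi ([jacobi]). Hence evaluating bracketed words of
    generators with it sends the Lie relations into I ([magma_eval_lie]), which
    amounts to a map from L(E) to the trees modulo I. It is inverse to Phi
    because the one-vertex trees generate all trees under grafting
    ([tree_generation]); this gives [Phi_onto] and [Phi_ker].

    Complement. The order on trees is well-founded ([tlt_wf]), so every element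
    can be reduced modulo I to a combination of trees in O(I) ([normal_form]).
    A nonzero such combination is never in I, for its leading tree would lie in
    T(I) ([O_independent]).

    Monomials. A tree with at least two branches at the root is in T(I)
    ([T_wide]): it is the leading tree of the generator of I formed from its
    least branch and the rest of the tree, unless that branch already has two
    branches itself; and a tree with a branch in T(I) is in T(I) ([T_branch]).
    So the trees of O(I) are ladders, built by successive graftings onto
    one-vertex trees, and Phi maps ladders to iterated brackets
    ([Phi_monomial]). *)

Set Implicit Arguments.
Unset Strict Implicit.
Unset Printing Implicit Defensive.

Import GRing.Theory.
Local Open Scope ring_scope.

(** * Subspaces, supports and bilinear extensions *)

(** The computation behind Jacobi, with p = (s -> t) -> u, q = (t -> s) -> u,
    y = t -> (s -> u), a = |s| and b = |t|: by the pre-Lie identity,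
    y - q + p is s -> (t -> u). *)
Lemma bracket_regroup (K : fieldType) (V : lmodType K) (a b : K) (y p q : V) :
  (a * b) *: (y - q + p) - (b * a) *: y - a *: ((a + b) *: p) =
  - (a *: (a *: p + b *: q)).
Proof.
rewrite mulrC !scalerDr scalerN scalerDl scalerDr !scalerA [b * a]mulrC !opprD.
rewrite [LHS](AC (3*1*2) ((1*4)*(3*6)*(5*2))) /=.
by rewrite !subrr !add0r.
Qed.

Lemma jacobi_regroup (V : zmodType) (x y z w v : V) :
  x + y + z = (x - w - v) + (y + w) + (z + v).
Proof. by rewrite [RHS](AC (3*2*2) ((1*4*6)*(2*5)*(3*7))) /= !addNr !addr0. Qed.

Section Subspaces.
Variable K : fieldType.

Lemma linear_map0 (V W : lmodType K) (u : V -> W) : linear u -> u 0 = 0.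
Proof.
by move=> lu; have := lu (-1) 0 0; rewrite !scaleN1r oppr0 addr0 addNr.
Qed.

Lemma linear_mapZ (V W : lmodType K) (u : V -> W) a x :
  linear u -> u (a *: x) = a *: u x.
Proof. by move=> lu; have := lu a x 0; rewrite (linear_map0 lu) !addr0. Qed.

Definition subspace (V : lmodType K) (J : V -> Prop) : Prop :=
  J 0 /\ forall a x y, J x -> J y -> J (a *: x + y).

Section Closure.
Variables (V : lmodType K) (J : V -> Prop).
Hypothesis sJ : subspace J.

Lemma subspaceZ a x : J x -> J (a *: x).
Proof.
by move=> Jx; rewrite -[_ *: _]addr0; apply: sJ.2 => //; apply: sJ.1.
Qed.

Lemma subspaceD x y : J x -> J y -> J (x + y).
Proof. by move=> Jx; rewrite -[x]scale1r; apply: sJ.2. Qed.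

Lemma subspaceN x : J x -> J (- x).
Proof. by move=> Jx; rewrite -scaleN1r; apply: subspaceZ. Qed.

Lemma subspaceB x y : J x -> J y -> J (x - y).
Proof. by move=> Jx Jy; apply: subspaceD => //; apply: subspaceN. Qed.

Lemma subspace_sum (I : eqType) (s : seq I) (F : I -> V) :
  (forall i, i \in s -> J (F i)) -> J (\sum_(i <- s) F i).
Proof.
move=> JF; rewrite big_seq; apply: (big_ind J) => //; first exact: sJ.1.
exact: subspaceD.
Qed.

Lemma subspace_mext (X : choiceType) (h : X -> V) (f : {malg K[X]}) :
  (forall x, x \in msupp f -> J (h x)) -> J (mext h f).
Proof.
by move=> Jh; rewrite mext_def; apply: subspace_sum => x /Jh; apply: subspaceZ.
Qed.

Lemma subspace_preim (W : lmodType K) (u : W -> V) :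
  linear u -> subspace (fun w => J (u w)).
Proof.
move=> lu; split=> [|a x y Jx Jy]; last by rewrite lu; apply: sJ.2.
by rewrite (linear_map0 lu); apply: sJ.1.
Qed.

End Closure.

Lemma malg_subspace (X : choiceType) (J : {malg K[X]} -> Prop) :
  subspace J -> (forall x, J << x >>) -> forall f, J f.
Proof. by move=> [J0 JP] JU f; apply: malg_lin_ind. Qed.

Lemma ideal_subspace (A : lmodType K) (mul : A -> A -> A) J :
  two_sided_ideal mul J -> subspace J.
Proof. by case. Qed.

Definition supported (X : choiceType) (P : X -> Prop) (f : {malg K[X]}) :
    Prop :=
  forall x, x \in msupp f -> P x.

Section Supported.
Variables (X : choiceType) (P : X -> Prop).

Lemma supported_subspace : subspace (@supported X P : {malg K[X]} -> Prop).
Proof.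
split=> [x|a f g Pf Pg x /(fsubsetP (msuppD_le _ _))]; first by rewrite msupp0.
rewrite in_fsetU => /orP[/(fsubsetP (msuppZ_le _ _))|]; first exact: Pf.
exact: Pg.
Qed.

Lemma supportedU x : P x -> @supported X P << x >>.
Proof. by move=> Px y /(fsubsetP msuppU_le); rewrite in_fset1 => /eqP->. Qed.

Lemma supported_mext (Y : choiceType) (Q : Y -> Prop) (h : Y -> {malg K[X]}) f :
  supported Q f -> (forall y, Q y -> supported P (h y)) ->
  supported P (mext h f).
Proof.
by move=> Qf Ph; apply: (subspace_mext supported_subspace) => y /Qf/Ph.
Qed.

End Supported.

Section BilinearExtension.
Variables (X : choiceType) (op : X -> X -> {malg K[X]}).

Lemma bextPl a f g h : bext op (a *: f + g) h = a *: bext op f h + bext op g h.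
Proof. exact: bextDl. Qed.

Lemma bext0l h : bext op 0 h = 0.
Proof. exact: linear_map0 (bextDl op h). Qed.

Lemma bext_addl f g h : bext op (f + g) h = bext op f h + bext op g h.
Proof. by have := bextPl 1 f g h; rewrite !scale1r. Qed.

Lemma bextZl a f h : bext op (a *: f) h = a *: bext op f h.
Proof. exact: linear_mapZ (bextDl op h). Qed.

Lemma bextBl f g h : bext op (f - g) h = bext op f h - bext op g h.
Proof. by rewrite -scaleN1r bext_addl bextZl scaleN1r. Qed.

Lemma bext_suml (I : Type) (r : seq I) (F : I -> {malg K[X]}) h :
  bext op (\sum_(i <- r) F i) h = \sum_(i <- r) bext op (F i) h.
Proof.
apply: (big_morph (fun f => bext op f h)) => [f g|]; first exact: bext_addl.
exact: bext0l.
Qed.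

Lemma supported_bext (P Q R : X -> Prop) f g :
  supported P f -> supported Q g ->
  (forall x y, P x -> Q y -> supported R (op x y)) -> supported R (bext op f g).
Proof.
move=> Pf Qg Rop; apply: (supported_mext Pf) => x Px.
by apply: (supported_mext Qg) => y; apply: Rop.
Qed.

End BilinearExtension.

End Subspaces.

(** * The pre-Lie identity for grafting *)

Section PlanarGrafting.
Variable d : nat -> nat.
Implicit Types (s t u v w : ptree d) (ss ts us vs : seq (ptree d)).

(** Named copy of the recursion on branches inside [grafts]. It grafts s onto
    a vertex of one of the trees of a forest, and acts as a derivation on the
    concatenation of branches; this is what makes the pre-Lie identity an
    induction. *)
Definition forest_grafts s : seq (ptree d) -> seq (seq (ptree d)) :=
  fix F us :=
  if us is u :: us' then
    [seq u' :: us' | u' <- grafts s u] ++ [seq u :: vs | vs <- F us']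
  else [::].

Lemma graftsE s a ts :
  grafts s (PNode a ts) =
  PNode a (s :: ts) :: [seq PNode a us | us <- forest_grafts s ts].
Proof. by []. Qed.

Lemma pdeg_node a ts : pdeg (PNode a ts) = (gdeg a + \sum_(t <- ts) pdeg t)%N.
Proof. by rewrite /= sumnE big_map. Qed.

Lemma pdeg_normalize t : pdeg (normalize t) = pdeg t.
Proof.
elim/ptree_ind_in: t => a ts IH; rewrite !pdeg_node -/normalize.
congr addn; rewrite (perm_big (map (@normalize d) ts)) ?perm_sort //.
by rewrite big_map !big_seq; apply: eq_bigr.
Qed.

(** The hypothesis on the trees of us is the induction hypothesis of
    [pdeg_graft], which is proved by simultaneous recursion on trees and
    forests. *)
Lemma pdeg_forest_graft s us vs :
  vs \in forest_grafts s us ->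
  (forall t u, t \in us -> u \in grafts s t -> pdeg u = (pdeg s + pdeg t)%N) ->
  size vs = size us /\
  (\sum_(v <- vs) pdeg v = pdeg s + \sum_(u <- us) pdeg u)%N.
Proof.
elim: us vs => //= u us IH vs; rewrite mem_cat => /orP[] /mapP[x xin ->] H.
  by rewrite /= !big_cons (H _ _ (mem_head _ _) xin) addnA.
rewrite /= !big_cons; have [|-> ->] := IH _ xin; last by rewrite addnCA.
by move=> t v tus; apply: H; rewrite inE tus orbT.
Qed.

Lemma pdeg_graft s t u : u \in grafts s t -> pdeg u = (pdeg s + pdeg t)%N.
Proof.
elim/ptree_ind_in: t u => a ts IH u; rewrite graftsE inE => /orP[/eqP->|].
  by rewrite !pdeg_node big_cons addnCA.
move=> /mapP[vs /pdeg_forest_graft H ->]; rewrite !pdeg_node.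
by have [|_ ->] := H; [move=> t v /IH; apply | rewrite addnCA].
Qed.

Lemma size_forest_graft s us vs :
  vs \in forest_grafts s us -> size vs = size us.
Proof. by case/pdeg_forest_graft => // t u _; apply: pdeg_graft. Qed.

Section Sums.
Variable V : zmodType.
Implicit Types (h : ptree d -> V) (k : seq (ptree d) -> V).

Definition tree_invariant h : Prop := forall s t, same_tree s t -> h s = h t.

(** Functions on lists of branches that factor through non-planar forests.
    Identities between multisets of non-planar trees are stated below by
    summing an arbitrary invariant function. *)
Definition forest_invariant k : Prop :=
  (forall us vs, perm_eq us vs -> k us = k vs) /\
  (forall u v us, same_tree u v -> k (u :: us) = k (v :: us)).

Lemma invariant_node h a : tree_invariant h -> forest_invariant (h \o PNode a).
Proof.
by move=> ih; split=> *; apply: ih; [apply: same_perm | apply: same_branch].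
Qed.

Lemma invariant_head k us :
  forest_invariant k -> tree_invariant (fun u => k (u :: us)).
Proof. by move=> ik u v; apply: ik.2. Qed.

Lemma invariant_tail k u :
  forest_invariant k -> forest_invariant (fun us => k (u :: us)).
Proof.
move=> ik; split=> [us vs p|v w us vw]; first by apply: ik.1; rewrite perm_cons.
have sw x y : perm_eq [:: x, y & us] [:: y, x & us].
  by rewrite (perm_catCA [:: x] [:: y] us).
by rewrite (ik.1 _ _ (sw u v)) (ik.1 _ _ (sw u w)); apply: ik.2.
Qed.

Lemma sum_grafts h s a ts :
  \sum_(u <- grafts s (PNode a ts)) h u =
  h (PNode a (s :: ts)) + \sum_(us <- forest_grafts s ts) h (PNode a us).
Proof. by rewrite graftsE big_cons big_map. Qed.

Lemma sum_forest_grafts k s u us :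
  \sum_(vs <- forest_grafts s (u :: us)) k vs =
  \sum_(v <- grafts s u) k (v :: us)
  + \sum_(vs <- forest_grafts s us) k (u :: vs).
Proof. by rewrite /= big_cat !big_map. Qed.

(** Rewrites the sum so that the order of the branches no longer matters: each
    branch is grafted on in turn and moved to the front, which an invariant k
    cannot see. *)
Lemma sum_forest_grafts_rem k s us : forest_invariant k ->
  \sum_(vs <- forest_grafts s us) k vs =
  \sum_(u <- us) \sum_(v <- grafts s u) k (v :: rem u us).
Proof.
elim: us k => [|u us IH] k ik; first by rewrite !big_nil.
rewrite sum_forest_grafts big_cons /= eqxx; congr (_ + _).
rewrite IH; last exact: invariant_tail.
rewrite !big_seq; apply: eq_bigr => w wus; apply: eq_bigr => v _.
apply: ik.1; case: eqVneq => [e|_].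
  rewrite -e in wus *; rewrite perm_sym.
  apply: (perm_trans (_ : perm_eq _ (v :: u :: rem u us))).
    by rewrite perm_cons perm_to_rem.
  by rewrite (perm_catCA [:: v] [:: u]).
by rewrite (perm_catCA [:: u] [:: v]).
Qed.

Lemma sum_forest_grafts_perm k s us vs : forest_invariant k -> perm_eq us vs ->
  \sum_(ws <- forest_grafts s us) k ws = \sum_(ws <- forest_grafts s vs) k ws.
Proof.
move=> ik p; rewrite !sum_forest_grafts_rem // (perm_big vs p) /=.
rewrite !big_seq; apply: eq_bigr => u uvs; apply: eq_bigr => v _; apply: ik.1.
rewrite perm_cons -(perm_cons u).
rewrite -(permPl (perm_to_rem _)) ?(perm_mem p) //.
by rewrite -(permPr (perm_to_rem uvs)).
Qed.

(** With [sum_grafts_same_l], grafting does not depend on the planar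
    representatives, so that normalizing between two graftings is harmless. *)
Lemma sum_grafts_same_r h s t u : tree_invariant h -> same_tree t u ->
  \sum_(v <- grafts s t) h v = \sum_(v <- grafts s u) h v.
Proof.
move=> ih tu; elim: tu h ih => {t u} //.
- by move=> t u _ IH h ih; rewrite IH.
- by move=> t u v _ IH1 _ IH2 h ih; rewrite IH1 // IH2.
- move=> a ts us p h ih; rewrite !sum_grafts.
  congr (_ + _); first by apply: ih; apply: same_perm; rewrite perm_cons.
  exact: (sum_forest_grafts_perm _ (invariant_node a ih)).
move=> a t u ts tu IH h ih; have ik := invariant_node a ih.
rewrite !sum_grafts !(sum_forest_grafts (h \o PNode a)).
congr (_ + (_ + _)).
- exact: (invariant_tail s ik).2.
- exact: (IH _ (invariant_head ts ik)).
by apply: eq_bigr => vs _; apply: ik.2.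
Qed.

Lemma sum_forest_grafts_same_l k s t us : forest_invariant k ->
  (forall u h, u \in us -> tree_invariant h ->
     \sum_(v <- grafts s u) h v = \sum_(v <- grafts t u) h v) ->
  \sum_(vs <- forest_grafts s us) k vs = \sum_(vs <- forest_grafts t us) k vs.
Proof.
move=> ik H; rewrite !sum_forest_grafts_rem // !big_seq.
apply: eq_bigr => u uus.
exact/H/invariant_head.
Qed.

Lemma sum_grafts_same_l h s t u : tree_invariant h -> same_tree s t ->
  \sum_(v <- grafts s u) h v = \sum_(v <- grafts t u) h v.
Proof.
move=> ih st; elim/ptree_ind_in: u h ih => a us IH h ih.
have ik := invariant_node a ih; rewrite !sum_grafts.
congr (_ + _); first exact: ik.2.
by apply: (sum_forest_grafts_same_l ik) => u h' uus; apply: IH.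
Qed.

(** The associator s -> (t -> u) - (s -> t) -> u, evaluated under h. *)
Definition assoc h s t u : V :=
  \sum_(v <- grafts t u) \sum_(x <- grafts s v) h x
  - \sum_(w <- grafts s t) \sum_(x <- grafts w u) h x.

Definition forest_assoc k s t us : V :=
  \sum_(vs <- forest_grafts t us) \sum_(xs <- forest_grafts s vs) k xs
  - \sum_(w <- grafts s t) \sum_(xs <- forest_grafts w us) k xs.

(** In s -> (t -> u), the terms that do not come from (s -> t) -> u have both s
    and t grafted at vertices of u. They are sorted by which of the two is
    grafted at the root; everything but the associator of the forest us is
    visibly symmetric in s and t. *)
Lemma assoc_node h s t a us :
  assoc h s t (PNode a us) =
  h (PNode a [:: s, t & us]) + forest_assoc (h \o PNode a) s t us
  + (\sum_(vs <- forest_grafts s us) h (PNode a (t :: vs))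
     + \sum_(vs <- forest_grafts t us) h (PNode a (s :: vs))).
Proof.
rewrite /assoc /forest_assoc sum_grafts sum_grafts /=.
rewrite (sum_forest_grafts (h \o PNode a)) /=.
under [X in _ + X - _]eq_bigr do rewrite sum_grafts.
under [X in _ - X]eq_bigr do rewrite sum_grafts.
rewrite !big_split /= opprD.
rewrite [LHS](AC (1*2*2*2) ((2*6)*(1*(5*7)*(3*4)))) /=.
by rewrite subrr add0r.
Qed.

(** Since grafting is a derivation on forests, the associator is one up to the
    cross terms, in which s and t are grafted onto different factors; these
    are symmetric in s and t. *)
Lemma forest_assoc_cons k s t u us :
  forest_assoc k s t (u :: us) =
  assoc (fun v => k (v :: us)) s t u
  + forest_assoc (fun vs => k (u :: vs)) s t us
  + (\sum_(v <- grafts s u) \sum_(vs <- forest_grafts t us) k (v :: vs)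
     + \sum_(v <- grafts t u) \sum_(vs <- forest_grafts s us) k (v :: vs)).
Proof.
rewrite /assoc /forest_assoc sum_forest_grafts.
under eq_bigr do rewrite sum_forest_grafts.
under [X in _ + X - _]eq_bigr do rewrite sum_forest_grafts.
under [X in _ - X]eq_bigr do rewrite sum_forest_grafts.
rewrite !big_split /= opprD.
rewrite [LHS](AC (2*2*2) ((1*5)*(4*6)*(3*2))) /=.
by congr (_ + (_ + _)); apply: exchange_big.
Qed.

(** The left pre-Lie identity; the induction on trees contains one on
    forests. *)
Lemma assoc_sym h s t u : tree_invariant h -> assoc h s t u = assoc h t s u.
Proof.
elim/ptree_ind_in: u h => a us IH h ih; rewrite !assoc_node.
have ik := invariant_node a ih.
congr (_ + _ + _); last by rewrite addrC.
  by apply: (ik.1 [:: s, t & us]); rewrite (perm_catCA [:: s] [:: t] us).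
elim: us (h \o _) ik IH => [|u us IHus] k ik IH.
  by rewrite /forest_assoc /= !big_nil !big1 // => w _; rewrite big_nil.
rewrite !forest_assoc_cons; congr (_ + _ + _); last by rewrite addrC.
  exact: (IH u (mem_head _ _) _ (invariant_head us ik)).
apply: (IHus _ (invariant_tail u ik)) => v vus.
by apply: IH; rewrite inE vus orbT.
Qed.

End Sums.
End PlanarGrafting.

(** * The order on planar representatives *)

Section TreeOrder.
Variable d : nat -> nat.
Implicit Types (s t u v x : ptree d) (ss ts us vs r : seq (ptree d)).

Definition branches t : seq (ptree d) := let: PNode _ ts := t in ts.

Lemma ptlt_deg s t : (pdeg s < pdeg t)%N -> ptlt s t.
Proof. by case: s t => a ss [b ts]; rewrite ptltE => ->. Qed.

Lemma ptlt_lexlt a b ss ts : pdeg (PNode a ss) = pdeg (PNode b ts) ->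
  size ss = size ts -> lexlt (@ptlt d) ss ts -> ptlt (PNode a ss) (PNode b ts).
Proof. by move=> e1 e2 l; rewrite ptltE e1 e2 !eqxx l !orbT. Qed.

(** Induction along the lexicographic order on lists of a fixed length whose
    entries are accessible: an outer induction on the head, an inner one on
    the tail. *)
Lemma lexlt_acc n (Q : seq (ptree d) -> Prop) :
  (forall ts, size ts = n ->
     (forall us, size us = n -> lexlt (@ptlt d) us ts ->
        (forall u, u \in us -> Acc (fun s t => ptlt s t) u) -> Q us) ->
     Q ts) ->
  forall ts, size ts = n ->
    (forall t, t \in ts -> Acc (fun s t => ptlt s t) t) -> Q ts.
Proof.
elim: n Q => [|n IHn] Q HQ; first by case=> // _ _; apply: HQ => // [[]].
case=> // t ts [sz] acc; have acct := acc _ (mem_head _ _).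
have {}acc v : v \in ts -> Acc (fun s t => ptlt s t) v.
  by move=> vts; apply: acc; rewrite inE vts orbT.
elim: acct ts sz acc => {}t _ IHt ts sz acc.
apply: (IHn (fun ts => Q (t :: ts))) acc => // {}ts {}sz IHts.
apply: HQ => [|[//|u us] [szu] /= lu accu]; first by rewrite /= sz.
have accus v : v \in us -> Acc (fun s t => ptlt s t) v.
  by move=> vts; apply: accu; rewrite inE vts orbT.
by case/orP: lu => [/IHt|/andP[/eqP-> lu]]; [apply | apply: IHts].
Qed.

(** Nested inductions follow the four clauses of the order: on the degree, the
    number of branches, the branches (which have smaller degree, hence are
    accessible), and the index of the root decoration among the generators of
    its degree. The last one suffices because trees of equal degree with the
    same branches have root decorations of equal degree. *)
Lemma ptlt_wf : well_founded (fun s t => ptlt s t).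
Proof.
suff step n : (forall u, (pdeg u < n)%N -> Acc (fun s t => ptlt s t) u) ->
    forall t, pdeg t = n -> Acc (fun s t => ptlt s t) t.
  move=> t; have [n] := ubnP (pdeg t).
  elim: n t => [t|n IHn t]; first by rewrite ltn0.
  rewrite ltnS => le_tn; apply: (step (pdeg t)) (erefl _) => u lt_ut.
  exact/IHn/(leq_trans lt_ut).
move=> IHn t; have [k] := ubnP (size (branches t)).
elim: k t => [t|k IHk [a ts]]; first by rewrite ltn0.
rewrite ltnS /= => le_k e.
have branch_acc b us : pdeg (PNode b us) = n ->
    forall u, u \in us -> Acc (fun s t => ptlt s t) u.
  move=> eus u uus; apply: IHn; rewrite -eus pdeg_node (big_rem u) //=.
  by rewrite addnCA -[X in (X < _)%N]addn0 ltn_add2l.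
pose Q us :=
  forall b, pdeg (PNode b us) = n -> Acc (fun s t => ptlt s t) (PNode b us).
suff Qts : Q ts by exact: (Qts a e).
apply: (lexlt_acc _ erefl (branch_acc a ts e)) => us szu IHus {e}a.
have [m] := ubnP (val (tagged a)).
elim: m a => [a|m IHm a]; first by rewrite ltn0.
rewrite ltnS => le_m ea; constructor=> -[b vs].
rewrite ptltE ea => /orP[/IHn//|]; case/andP=> /eqP eb /orP[szv|].
  by apply: IHk => //=; rewrite (leq_trans szv) ?szu.
case/andP=> /eqP szv /orP[lv|/andP[/eqP evs gba]].
  by apply: (IHus vs _ lv (branch_acc b vs eb) b eb); rewrite szv.
rewrite {}evs {vs szv} in eb *; apply: (IHm b _ eb); apply: leq_trans le_m.
move: ea; rewrite -eb !pdeg_node => /addIn eab.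
by move: gba; rewrite /glt eab ltnn eqxx.
Qed.

Lemma sort_min x r :
  all (ptle x) r -> sort (@ptle d) (x :: r) = x :: sort (@ptle d) r.
Proof.
move=> xr; apply: (sorted_eq (@ptle_trans d) (@ptle_anti d)).
- exact/sort_sorted/ptle_total.
- rewrite /= (path_sortedE (@ptle_trans d)) all_sort xr.
  exact/sort_sorted/ptle_total.
by rewrite perm_sort perm_cons perm_sym perm_sort.
Qed.

Lemma sort_perm us vs : perm_eq us vs -> sort (@ptle d) us = sort (@ptle d) vs.
Proof. by move/(perm_sortP (@ptle_total d) (@ptle_trans d) (@ptle_anti d)). Qed.

Lemma ptltNle s t : ptlt s t = ~~ ptle t s.
Proof.
rewrite /ptle; case/or3P: (ptlt_total s t) => [/eqP->|st|ts].
- by rewrite eqxx ptlt_irr.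
- rewrite st negb_or; apply/esym/andP; split.
    by apply: contraTneq st => ->; rewrite ptlt_irr.
  by apply/negP=> /(ptlt_trans st); rewrite ptlt_irr.
rewrite ts orbT; apply/negbTE/negP=> /ptlt_trans/(_ ts).
by rewrite ptlt_irr.
Qed.

(** Replacing a branch by a smaller one makes the tree smaller, whatever
    position the branch takes after sorting. By induction on the sorted common
    part r, comparing u and s with its least entry x. *)
Lemma lexlt_sort_cons u s r : ptlt u s ->
  lexlt (@ptlt d) (sort (@ptle d) (u :: r)) (sort (@ptle d) (s :: r)).
Proof.
move=> us.
have es v : sort (@ptle d) (v :: r) = sort (@ptle d) (v :: sort (@ptle d) r).
  by apply: sort_perm; rewrite perm_cons perm_sym perm_sort.
rewrite !{}es; have := sort_sorted (@ptle_total d) r.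
elim: (sort _ r) => [|x {}r IH] /=; first by rewrite us.
rewrite (path_sortedE (@ptle_trans d)) => /andP[xr /IH{}IH].
have swap v : sort (@ptle d) [:: v, x & r] = sort (@ptle d) [:: x, v & r].
  by apply: sort_perm; rewrite (perm_catCA [:: v] [:: x] r).
have below v : ptle v x -> all (ptle v) (x :: r).
  move=> vx /=; rewrite vx /=; apply: sub_all xr => y; exact: ptle_trans.
have [xu|] := boolP (ptle x u).
  have xs : ptle x s by apply: ptle_trans xu _; rewrite /ptle us orbT.
  rewrite !swap (sort_min (_ : all _ (u :: r))) /= ?xu //.
  by rewrite (sort_min (_ : all _ (s :: r))) /= ?xs // eqxx IH orbT.
rewrite -ptltNle => ux; have le_ux : ptle u x by rewrite /ptle ux orbT.
rewrite (sort_min (below u le_ux)).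
have [xs|] := boolP (ptle x s).
  by rewrite swap (sort_min (_ : all _ (s :: r))) /= ?xs ?ux.
rewrite -ptltNle => sx; have le_sx : ptle s x by rewrite /ptle sx orbT.
by rewrite (sort_min (below s le_sx)) /= us.
Qed.

(** The first entries already decide: the least entry of us is at most x. *)
Lemma lexlt_sort_min x us vs : x \in us -> all (ptlt x) vs -> vs != [::] ->
  lexlt (@ptlt d) (sort (@ptle d) us) (sort (@ptle d) vs).
Proof.
move=> xus xvs vs0; have := mem_sort (@ptle d) us x; rewrite xus.
have := sort_sorted (@ptle_total d) us; case: (sort _ us) => // y us' /=.
rewrite (path_sortedE (@ptle_trans d)) => /andP[/allP yus' _].
have := perm_sort (@ptle d) vs vs; rewrite perm_refl.
case E: (sort _ vs) => [|z vs'] p.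
  by have/perm_size := p; case: vs vs0 {E p xvs}.
have xz : ptlt x z by apply: (allP xvs); rewrite -(perm_mem p) mem_head.
rewrite inE /= => /orP[/eqP<-|/yus']; first by rewrite xz.
by rewrite /ptle => /orP[/eqP->|/ptlt_trans->]; rewrite ?xz.
Qed.

End TreeOrder.

(** * Trees: order, grafting, generation *)

Section Trees.
Variables (K : fieldType) (d : nat -> nat).
Implicit Types (s t u : tree d) (p q : ptree d) (us ts : seq (ptree d)).

Definition tlt s t : bool := ptlt (val s) (val t).

Definition width t : nat := size (branches (val t)).

Lemma tlt_wf : well_founded (fun s t => tlt s t).
Proof. exact: (wf_inverse_image _ _ _ val (@ptlt_wf d)). Qed.

Lemma mktree_val t : mktree (val t) = t.
Proof. by apply: val_inj; apply: normalize_id; apply: (valP t). Qed.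

Lemma mktree_same p q : same_tree p q -> mktree p = mktree q.
Proof. by move/normalizeP => e; apply: val_inj. Qed.

Lemma tdeg_mktree p : tdeg (mktree p) = pdeg p.
Proof. exact: pdeg_normalize. Qed.

Lemma width_mktree p : width (mktree p) = size (branches p).
Proof. by case: p => a us; rewrite /width /= size_sort size_map. Qed.

Lemma tdeg_gt0 t : (0 < tdeg t)%N.
Proof. by rewrite /tdeg; case: (val t) => a ts; rewrite pdeg_node. Qed.

Lemma canonical_branches t : all (@Defs.canonical d) (branches (val t)).
Proof. by have := valP t; case: (val t) => a ts /= /andP[]. Qed.

Lemma val_mktree_node a us : all (@Defs.canonical d) us ->
  val (mktree (PNode a us)) = PNode a (sort (@ptle d) us).
Proof.
move=> /allP can /=; congr (PNode a (sort _ _)).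
by rewrite -[RHS]map_id; apply/eq_in_map => u /can/normalize_id.
Qed.

Lemma tree_node t :
  exists a ts, [/\ val t = PNode a ts, sorted (@ptle d) ts,
                   all (@Defs.canonical d) ts & t = mktree (PNode a ts)].
Proof.
have := valP t; have := mktree_val t; case: (val t) => a ts <- /andP[so can].
by exists a, ts; split.
Qed.

Lemma tlt_deg s t : (tdeg s < tdeg t)%N -> tlt s t.
Proof. exact: ptlt_deg. Qed.

Lemma tlt_width s t : tdeg s = tdeg t -> (width s < width t)%N -> tlt s t.
Proof.
rewrite /tlt /tdeg /width; case: (val s) (val t) => a ss [b ts] e lt_w.
by rewrite ptltE e eqxx lt_w orbT.
Qed.

Lemma tlt_lexlt a b us ts :
  all (@Defs.canonical d) us -> all (@Defs.canonical d) ts ->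
  pdeg (PNode a us) = pdeg (PNode b ts) -> size us = size ts ->
  lexlt (@ptlt d) (sort (@ptle d) us) (sort (@ptle d) ts) ->
  tlt (mktree (PNode a us)) (mktree (PNode b ts)).
Proof.
move=> cus cts e sz lt_l; rewrite /tlt !val_mktree_node //.
apply: ptlt_lexlt => //.
  rewrite -(val_mktree_node _ cus) -(val_mktree_node _ cts).
  by rewrite !pdeg_normalize.
by rewrite !size_sort.
Qed.

Lemma tlt_irr t : tlt t t = false.
Proof. exact: ptlt_irr. Qed.

Lemma tle_eqVlt s t : tle s t = (s == t) || tlt s t.
Proof. by []. Qed.

Notation graft := (@graft K d).
Notation tA := (treeAlg K d).

Lemma graftUU s t :
  graft << s >> << t >> = \sum_(u <- grafts (val s) (val t)) << mktree u >>.
Proof. exact: bextUU. Qed.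

Lemma mktree_invariant : tree_invariant (fun p => << mktree p >> : tA).
Proof. by move=> p q pq; rewrite (mktree_same pq). Qed.

(** Transfers the planar associator to non-planar trees; the two
    normalizations hidden in the composite graftings are absorbed by
    [sum_grafts_same_r] and [sum_grafts_same_l]. *)
Lemma graft_assoc s t u :
  graft << s >> (graft << t >> << u >>) - graft (graft << s >> << t >>) << u >>
  = assoc (fun p => << mktree p >> : tA) (val s) (val t) (val u).
Proof.
have inv := mktree_invariant.
rewrite /assoc !graftUU /graft linear_sum bext_suml /=; congr (_ - _).
  apply: eq_bigr => v _; rewrite bextUU.
  exact/esym/(sum_grafts_same_r _ inv (same_normalize v)).
apply: eq_bigr => v _; rewrite bextUU.
exact/esym/(sum_grafts_same_l _ inv (same_normalize v)).
Qed.

Lemma graft_prelie s t u :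
  graft << s >> (graft << t >> << u >>) - graft (graft << s >> << t >>) << u >>
  =
  graft << t >> (graft << s >> << u >>) - graft (graft << t >> << s >>) << u >>.
Proof. by rewrite !graft_assoc; apply/assoc_sym/mktree_invariant. Qed.

(** Grafting at the root yields one branch more than grafting anywhere else,
    hence the largest term. The error term g has to be known by degree and
    width only. *)
Lemma graft_root s t a ts : val t = PNode a ts ->
  exists2 g : tA,
    supported (fun u => tdeg u = (tdeg s + tdeg t)%N /\ width u = size ts) g
    & graft << s >> << t >> = << mktree (PNode a (val s :: ts)) >> + g.
Proof.
move=> vt; rewrite graftUU vt graftsE big_cons big_map.
eexists; last reflexivity.
apply: subspace_sum => [|us us_in]; first exact: supported_subspace.
apply: supportedU; rewrite tdeg_mktree width_mktree; split.
  rewrite (@pdeg_graft _ (val s) (val t)) // vt graftsE inE; apply/orP; right.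
  exact: map_f.
exact: size_forest_graft us_in.
Qed.

(** One-vertex trees generate all trees under grafting. Detach a branch s from
    t, leaving t': by [graft_root], s -> t' is t plus trees with fewer
    branches at the root. All of s, t' and these trees are smaller than t, so
    well-founded induction applies. The index n tracks the degree, for
    properties that speak of homogeneous elements. *)
Lemma tree_generation (P : nat -> tA -> Prop) :
  (forall n, subspace (P n)) ->
  (forall a, P (gdeg a) << vertex a >>) ->
  (forall s t, P (tdeg s) << s >> -> P (tdeg t) << t >> ->
     P (tdeg s + tdeg t)%N (graft << s >> << t >>)) ->
  forall t, P (tdeg t) << t >>.
Proof.
move=> Psub Pgen Pgraft; apply: (well_founded_induction tlt_wf) => t IH.
have [a [ts [vt so can et]]] := tree_node t.
case: ts => [|r ts] in vt so can et.
  by rewrite et tdeg_mktree pdeg_node big_nil addn0; apply: Pgen.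
have /andP[cr cts] := can; have sts := path_sorted so.
pose s : tree d := exist (fun p => Defs.canonical p) r cr.
have ct : Defs.canonical (PNode a ts) by apply/andP.
pose t' : tree d := exist (fun p => Defs.canonical p) (PNode a ts) ct.
have degt : tdeg t = (tdeg s + tdeg t')%N.
  by rewrite /tdeg vt !pdeg_node big_cons addnCA.
have [g supg eg] := @graft_root s t' a ts erefl.
rewrite -et in eg; have -> : << t >> = graft << s >> << t' >> - g.
  by rewrite eg addrK.
apply: (subspaceB (Psub _)).
  rewrite degt; apply: Pgraft; apply: IH; apply: tlt_deg; rewrite degt.
    by rewrite -{1}[tdeg s]addn0 ltn_add2l tdeg_gt0.
  by rewrite -{1}[tdeg t']add0n ltn_add2r tdeg_gt0.
rewrite [g]malg_mext; apply: (subspace_mext (Psub _)) => u /supg[du wu].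
rewrite degt -du; apply: IH; apply: tlt_width; first by rewrite du.
by rewrite wu /width vt.
Qed.

End Trees.

(** * The kernel of Phi *)

Lemma lbr_anti (K : fieldType) (d : nat -> nat) (x y : freeLie K d) :
  lbr x y + lbr y x = 0.
Proof.
have [[bl br] bxx _] := lbr_lie K d.
have := bxx (x + y); have := bl (x + y) 1 x y; rewrite !scale1r => ->.
have := br x 1 x y; have := br y 1 x y; rewrite !scale1r => -> ->.
by rewrite !bxx add0r addr0.
Qed.

Section QuotientLieAlgebra.
Variables (K : fieldType) (d : nat -> nat).
Hypothesis charK : [pchar K] =i pred0.
Implicit Types (s t u : tree d).

Notation tA := (treeAlg K d).
Notation graft := (@graft K d).
Notation I := (I_ideal K d).

Lemma natr_neq0 n : (0 < n)%N -> (n%:R : K) != 0.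
Proof. by move/pcharf0P: charK => ->; rewrite lt0n. Qed.

Lemma I_twosided : two_sided_ideal graft I.
Proof. exact: ideal_gen_ideal. Qed.

Lemma I_subspace : subspace I.
Proof. exact: ideal_subspace I_twosided. Qed.

Lemma I_graftr f g : I g -> I (graft f g).
Proof. by case: I_twosided => _ _ + _; apply. Qed.

Lemma I_graftl f g : I f -> I (graft f g).
Proof. by case: I_twosided => _ _ _; apply. Qed.

Lemma I_gen s t :
  I ((tdeg s)%:R *: graft << s >> << t >>
     + (tdeg t)%:R *: graft << t >> << s >>).
Proof. by apply: ideal_gen_sub; exists s, t. Qed.

(** The bracket |s| (s -> t), to be read modulo I, where it turns out to be
    the Lie bracket of L(E). *)
Definition tree_bracket : tA -> tA -> tA :=
  bext (fun s t => (tdeg s)%:R *: graft_tree K s t).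

Lemma tree_bracket_linear f : linear (tree_bracket f).
Proof. exact: bextDr. Qed.

HB.instance Definition _ f :=
  GRing.isLinear.Build K tA tA *:%R (tree_bracket f) (tree_bracket_linear f).

Lemma tree_bracketPl a f g h :
  tree_bracket (a *: f + g) h = a *: tree_bracket f h + tree_bracket g h.
Proof. exact: bextPl. Qed.

Lemma tree_bracket0l h : tree_bracket 0 h = 0.
Proof. exact: bext0l. Qed.

Lemma tree_bracketBl f g h :
  tree_bracket (f - g) h = tree_bracket f h - tree_bracket g h.
Proof. exact: bextBl. Qed.

Lemma tree_bracketZl a f h : tree_bracket (a *: f) h = a *: tree_bracket f h.
Proof. exact: bextZl. Qed.

Lemma tree_bracketU s g :
  tree_bracket << s >> g = (tdeg s)%:R *: graft << s >> g.
Proof.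
rewrite /tree_bracket /Defs.graft /bext !mextU !mext_def scaler_sumr.
by apply: eq_bigr => t _; rewrite !scalerA mulrC.
Qed.

Lemma I_bracketr f g : I g -> I (tree_bracket f g).
Proof.
move=> Ig; elim/malg_subspace: f => [|s].
  exact: (subspace_preim I_subspace (bextDl _ g)).
by rewrite tree_bracketU; apply: (subspaceZ I_subspace); apply: I_graftr.
Qed.

Lemma I_anti f g : I (tree_bracket f g + tree_bracket g f).
Proof.
elim/malg_lin_ind: f => [|a f1 f2 IH1 IH2|s].
- rewrite tree_bracket0l linear0 addr0; exact: I_subspace.1.
- by rewrite tree_bracketPl linearP addrACA -scalerDr; apply: I_subspace.2.
elim/malg_lin_ind: g => [|a g1 g2 IH1 IH2|t].
- rewrite tree_bracket0l linear0 addr0; exact: I_subspace.1.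
- by rewrite tree_bracketPl linearP addrACA -scalerDr; apply: I_subspace.2.
by rewrite !tree_bracketU; apply: I_gen.
Qed.

(** The weight of the bracket depends on the homogeneous components of f, so
    stability under grafting does not suffice here; antisymmetry reduces to
    [I_bracketr]. *)
Lemma I_bracketl f g : I f -> I (tree_bracket f g).
Proof.
move=> If; rewrite -[tree_bracket f g](addrK (tree_bracket g f)).
by apply: (subspaceB I_subspace); [apply: I_anti | apply: I_bracketr].
Qed.

Lemma graft_bracket s g :
  graft << s >> g = (tdeg s)%:R^-1 *: tree_bracket << s >> g.
Proof.
by rewrite tree_bracketU scalerA mulVf ?scale1r //; apply/natr_neq0/tdeg_gt0.
Qed.

Lemma I_bracket_congr f f' g g' :
  I (f - f') -> I (g - g') -> I (tree_bracket f g - tree_bracket f' g').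
Proof.
move=> /(I_bracketl g) If /(I_bracketr f') Ig.
have := subspaceD I_subspace If Ig.
by rewrite tree_bracketBl linearB /= addrA subrK.
Qed.

Lemma tree_bracket_homogeneous n f g : supported (fun s => tdeg s = n) f ->
  tree_bracket f g = n%:R *: graft f g.
Proof.
move=> degf.
rewrite /tree_bracket /Defs.graft /bext !(mext_def _ f) scaler_sumr.
rewrite big_seq [RHS]big_seq; apply: eq_bigr => s /degf <-.
have := tree_bracketU s g; rewrite /tree_bracket /Defs.graft /bext !mextU => ->.
by rewrite !scalerA mulrC.
Qed.

Lemma tree_bracket_graft s t g :
  tree_bracket (graft << s >> << t >>) g =
  (tdeg s + tdeg t)%:R *: graft (graft << s >> << t >>) g.
Proof.
apply: tree_bracket_homogeneous; rewrite graftUU.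
apply: subspace_sum => [|p /pdeg_graft degp]; first exact: supported_subspace.
by apply: supportedU; rewrite tdeg_mktree degp.
Qed.

Local Notation tb := tree_bracket.

Lemma tree_bracketDr f g h : tb f (g + h) = tb f g + tb f h.
Proof. exact: linearD. Qed.

Lemma graftZr a f g : graft f (a *: g) = a *: graft f g.
Proof. by rewrite /Defs.graft linearZ. Qed.

Lemma graft_lincomb a f c g h :
  graft (a *: f + c *: g) h = a *: graft f h + c *: graft g h.
Proof.
transitivity (a *: graft f h + graft (c *: g) h); first exact: bextPl.
by congr (_ + _); apply: bextZl.
Qed.

Lemma tree_bracket2 s t g :
  tb << s >> (tb << t >> g) =
  ((tdeg s)%:R * (tdeg t)%:R) *: graft << s >> (graft << t >> g).
Proof. by rewrite tree_bracketU (tree_bracketU t) graftZr scalerA. Qed.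

(** The defect of Jacobi is a multiple of a generator of I grafted onto u. By
    the pre-Lie identity, the first two terms give |s| |t| times
    (s -> t - t -> s) -> u, while the third one is |s| (|s| + |t|) times
    (s -> t) -> u since s -> t has degree |s| + |t|. *)
Lemma bracket_derivation s t u :
  tb << s >> (tb << t >> << u >>) - tb << t >> (tb << s >> << u >>)
  - tb (tb << s >> << t >>) << u >> =
  - ((tdeg s)%:R *: graft ((tdeg s)%:R *: graft << s >> << t >>
                          + (tdeg t)%:R *: graft << t >> << s >>) << u >>).
Proof.
have /eqP := graft_prelie K s t u; rewrite subr_eq => /eqP pre.
rewrite !tree_bracket2 (tree_bracketU s) tree_bracketZl tree_bracket_graft.
rewrite graft_lincomb.
by rewrite {}pre natrD; apply: bracket_regroup.
Qed.

(** Antisymmetry turns the cyclic form of Jacobi into the form of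
    [bracket_derivation]. *)
Lemma jacobi_trees s t u :
  I (tb << s >> (tb << t >> << u >>) + tb << t >> (tb << u >> << s >>)
     + tb << u >> (tb << s >> << t >>)).
Proof.
set S := << s >>; set T := << t >>; set U := << u >>.
(* The last two summands are antisymmetry defects, which lie in I. *)
have -> : tb S (tb T U) + tb T (tb U S) + tb U (tb S T) =
    (tb S (tb T U) - tb T (tb S U) - tb (tb S T) U)
    + tb T (tb U S + tb S U) + (tb U (tb S T) + tb (tb S T) U).
  rewrite [LHS](jacobi_regroup _ _ _ (tb T (tb S U)) (tb (tb S T) U)).
  by congr (_ + _ + _); rewrite -(tree_bracketDr T).
apply: (subspaceD I_subspace); last exact: I_anti.
apply: (subspaceD I_subspace); last by apply: I_bracketr; apply: I_anti.
rewrite bracket_derivation.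
apply: (subspaceN I_subspace); apply: (subspaceZ I_subspace).
by apply: I_graftl; apply: I_gen.
Qed.

Definition jac (f g h : tA) : tA :=
  tree_bracket f (tree_bracket g h) + tree_bracket g (tree_bracket h f)
  + tree_bracket h (tree_bracket f g).

Lemma jac_rot f g h : jac f g h = jac g h f.
Proof. by rewrite /jac -addrA addrC. Qed.

Lemma jac_linear g h : linear (fun f => jac f g h).
Proof.
move=> a f f'; rewrite /jac !tree_bracketPl !linearP /= !scalerDr.
by rewrite [LHS](AC (2*2*2) ((1*3*5)*(2*4*6))).
Qed.

Lemma jacobi f g h : I (jac f g h).
Proof.
have lin g' h' : subspace (fun f => I (jac f g' h')).
  exact: (subspace_preim I_subspace (jac_linear g' h')).
elim/malg_subspace: f => // s; rewrite jac_rot.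
elim/malg_subspace: g => // t; rewrite jac_rot.
by elim/malg_subspace: h => // u; rewrite jac_rot; apply: jacobi_trees.
Qed.

(** Evaluates a bracketed word of generators with [tree_bracket]. Its linear
    extension [magma_eval] sends the Lie relations into I, so it represents a
    linear map from L(E) to the trees modulo I without a quotient being
    formed. *)
Fixpoint magma_tree (w : magma d) : tA :=
  match w with
  | Gen a => << vertex a >>
  | Br v w => tree_bracket (magma_tree v) (magma_tree w)
  end.

Definition magma_eval : magmaAlg K d -> tA := mext magma_tree.

Lemma magma_eval_mul f g :
  magma_eval (magma_mul f g) = tree_bracket (magma_eval f) (magma_eval g).
Proof.
elim/malg_lin_ind: f => [|a f1 f2 IH1 IH2|v].
- by rewrite magma_mul0l /magma_eval linear0 tree_bracket0l.
- rewrite magma_mulDl magma_mulZl /magma_eval !linearP /= -/(magma_eval _) IH1.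
  by rewrite -/(magma_eval (magma_mul f2 g)) IH2 tree_bracketPl.
elim/malg_lin_ind: g => [|a g1 g2 IH1 IH2|w].
- by rewrite linear0 /magma_eval !linear0.
- rewrite linearP /magma_eval !linearP /= -/(magma_eval _) IH1.
  by rewrite -/(magma_eval (magma_mul << v >> g2)) IH2.
by rewrite /magma_mul bextUU /magma_eval !mextU.
Qed.

Lemma magma_eval_linear : linear magma_eval.
Proof. exact: linearP. Qed.

Lemma magma_evalZ a f : magma_eval (a *: f) = a *: magma_eval f.
Proof. exact: linearZ. Qed.

Lemma magma_eval_lie f : lie_ideal f -> I (magma_eval f).
Proof.
move=> Jf; apply: (Jf (fun f => I (magma_eval f))).
  have [I0 IP] := subspace_preim I_subspace magma_eval_linear.
  split=> // x y; rewrite magma_eval_mul; first exact: I_bracketr.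
  exact: I_bracketl.
have magma_evalD g h : magma_eval (g + h) = magma_eval g + magma_eval h.
  exact: linearD.
move=> _ [[x ->]|[x [y [z ->]]]]; last first.
  by rewrite !magma_evalD !magma_eval_mul; apply: jacobi.
rewrite magma_eval_mul -[tree_bracket _ _]scale1r.
rewrite -(@mulVf _ (2%:R : K)) ?natr_neq0 // -scalerA scaler_nat mulr2n.
by apply: (subspaceZ I_subspace); apply: I_anti.
Qed.

Section Morphism.
Variable Phi : {linear tA -> freeLie K d}.
Hypothesis Phi_prelie : forall f g : tA, Phi (graft f g) = rhd (Phi f) (Phi g).
Hypothesis Phi_gen : forall a : gen d, Phi << vertex a >> = lgen K a.

Lemma homogeneous_subspace n : subspace (@homogeneous K d n).
Proof.
split=> [|a x y [f -> Hf] [g -> Hg]].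
  by exists 0; rewrite ?linear0 // => w; rewrite msupp0.
exists (a *: f + g); first by rewrite linearP.
exact: ((supported_subspace K (fun w => Defs.mdeg w = n)).2 a f g Hf Hg).
Qed.

Lemma homogeneous_lbr m n (x y : freeLie K d) :
  homogeneous m x -> homogeneous n y -> homogeneous (m + n) (lbr x y).
Proof.
move=> [f -> Hf] [g -> Hg]; exists (magma_mul f g); first by rewrite lbr_lpi.
apply: (@supported_bext _ _ _
  (fun w => Defs.mdeg w = m) (fun w => Defs.mdeg w = n)
  (fun w => Defs.mdeg w = (m + n)%N)) => // v w <- <-; exact: supportedU.
Qed.

(** The pre-Lie product of L(E) divides by the degree of its first argument;
    by homogeneity this is a scalar factor in [Phi_graft]. *)
Lemma Phi_homogeneous t : homogeneous (tdeg t) (Phi << t >>).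
Proof.
apply: (tree_generation (P := fun n f => homogeneous n (Phi f))).
- by move=> n; apply: (subspace_preim (homogeneous_subspace n)); apply: linearP.
- by move=> a; rewrite Phi_gen; exists << Gen a >> => //; apply: supportedU.
move=> s {}t hs ht; rewrite Phi_prelie (rhd_homogeneous _ _ hs) //.
by apply: (subspaceZ (homogeneous_subspace _)); apply: homogeneous_lbr.
Qed.

Lemma Phi_graft s g :
  Phi (graft << s >> g) = (tdeg s)%:R^-1 *: lbr (Phi << s >>) (Phi g).
Proof. by rewrite Phi_prelie (rhd_homogeneous charK _ (Phi_homogeneous s)). Qed.

Lemma Phi_bracket f g : Phi (tree_bracket f g) = lbr (Phi f) (Phi g).
Proof.
have [[bl br] _ _] := lbr_lie K d.
elim/malg_lin_ind: f => [|a f1 f2 IH1 IH2|s].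
- by rewrite tree_bracket0l linear0 (linear_map0 (bl _)).
- by rewrite tree_bracketPl !linearP /= bl -IH1 -IH2.
rewrite tree_bracketU linearZ /= Phi_graft scalerA mulfV ?scale1r //.
exact/natr_neq0/tdeg_gt0.
Qed.

(** On words, Phi inverts the evaluation; surjectivity of Phi is a
    consequence. *)
Lemma Phi_magma_eval m : Phi (magma_eval m) = lpi m.
Proof.
elim/malg_lin_ind: m => [|a f g IH1 IH2|w].
- by rewrite /magma_eval !linear0.
- by rewrite magma_eval_linear linearP IH1 IH2 lpiD lpiZ.
rewrite /magma_eval mextU; elim: w => [a|v IHv w IHw] /=; first exact: Phi_gen.
by rewrite Phi_bracket IHv IHw lbr_lpi /magma_mul bextUU.
Qed.

Lemma Phi_onto x : exists f, Phi f = x.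
Proof. by exists (magma_eval (repr x)); rewrite Phi_magma_eval lreprK. Qed.

(** The converse of [Phi_magma_eval] modulo I: evaluating any lift of Phi f
    gives back f up to I. Such f form a subspace that contains the one-vertex
    trees and is stable under grafting of trees: [tree_generation] applies. *)
Lemma Phi_section f : exists2 m, lpi m = Phi f & I (magma_eval m - f).
Proof.
pose P f := exists2 m, lpi m = Phi f & I (magma_eval m - f).
have sP : subspace P.
  split=> [|a g h [m em Im] [n en In]].
    exists 0; first by rewrite !linear0.
    by rewrite subr0 /magma_eval linear0; apply: I_subspace.1.
  exists (a *: m + n); first by rewrite !linearP /= em en.
  by rewrite magma_eval_linear opprD addrACA -scalerBr; apply: I_subspace.2.
apply: (malg_subspace sP) => t; apply: (tree_generation (P := fun=> P)) => //.
  move=> a; exists << Gen a >>; first by rewrite Phi_gen.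
  by rewrite /magma_eval mextU subrr; apply: I_subspace.1.
move=> s {}t [m em Im] [n en In]; exists ((tdeg s)%:R^-1 *: magma_mul m n).
  by rewrite linearZ /= -lbr_lpi em en Phi_graft.
have := subspaceZ I_subspace (tdeg s)%:R^-1 (I_bracket_congr Im In).
by rewrite scalerBr -graft_bracket -magma_eval_mul -magma_evalZ.
Qed.

(** If Phi f = 0, the lift m of [Phi_section] is a consequence of the Lie
    relations, so its evaluation lies in I, and so does f. Conversely the
    kernel is an ideal, and it contains the generators of I by antisymmetry of
    the Lie bracket. *)
Lemma Phi_ker f : Phi f = 0 <-> I f.
Proof.
split=> [f0|If].
  have [m em Im] := Phi_section f.
  rewrite -[f](subKr (magma_eval m)); apply: (subspaceB I_subspace) => //.
  apply: magma_eval_lie; rewrite -[m]subr0.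
  by apply/lpi_eq; rewrite em f0 linear0.
have [rl rr] := @rhd_bilinear K d charK.
apply: (If (fun f => Phi f = 0)).
  split=> [|a g h eg eh|g h e|g h e]; first exact: linear0.
  - by rewrite linearP eg eh scaler0 addr0.
  - by rewrite Phi_prelie e (linear_map0 (rr _)).
  - by rewrite Phi_prelie e (linear_map0 (rl _)).
move=> _ [s [t ->]].
by rewrite -!tree_bracketU linearD /= !Phi_bracket lbr_anti.
Qed.

End Morphism.
End QuotientLieAlgebra.

(** * Leading trees of the ideal *)

Lemma lead_regroup (K : fieldType) (V : lmodType K) (a b : K) (x y t g : V) :
  a != 0 -> x = t + g ->
  a^-1 *: (a *: x + b *: y) = t + (g + a^-1 *: (b *: y)).
Proof. by move=> a0 ->; rewrite scalerDr scalerA mulVf // scale1r addrA. Qed.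

Section LeadingTrees.
Variables (K : fieldType) (d : nat -> nat).
Hypothesis charK : [pchar K] =i pred0.
Implicit Types (s t u w : tree d) (ts : seq (ptree d)).

Notation tA := (treeAlg K d).
Notation graft := (@graft K d).
Notation I := (I_ideal K d).

Definition below t : tA -> Prop := supported (fun u => tlt u t).

Lemma below_subspace t : subspace (below t).
Proof. exact: supported_subspace. Qed.

(** The leading coefficient can be taken to be 1, which turns statements on
    leading trees into congruences. *)
Lemma T_setP (J : set tA) t : subspace J ->
  T_set J t <-> exists2 g, below t g & J (<< t >> + g).
Proof.
move=> sJ; split=> [[f [Jf f0 [tf leading]]]|[g bg Jg]].
  have ft0 : f@_t != 0 by rewrite mcoeff_neq0.
  exists ((f@_t)^-1 *: f - << t >>); last first.
    by rewrite addrC subrK; apply: (subspaceZ sJ).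
  move=> u; rewrite -mcoeff_neq0 mcoeffB mcoeffZ mcoeffU.
  have [<-|/negbTE tu] := eqVneq t u; first by rewrite mulVf // subrr eqxx.
  rewrite subr0 mulf_eq0 negb_or mcoeff_neq0 => /andP[_ /leading].
  by rewrite tle_eqVlt eq_sym tu.
have ft : (<< t >> + g)@_t = 1.
  rewrite mcoeffD mcoeffUU mcoeff_outdom ?addr0 //.
  by apply/negP => /bg; rewrite tlt_irr.
exists (<< t >> + g); split=> //.
  by apply: contra_eq_neq ft => ->; rewrite mcoeff0 eq_sym oner_eq0.
split=> [|u]; first by rewrite -mcoeff_neq0 ft oner_eq0.
move=> /(fsubsetP (msuppD_le _ _)); rewrite in_fsetU tle_eqVlt.
case/orP=> [/(fsubsetP msuppU_le)|/bg->]; last by rewrite orbT.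
by rewrite in_fset1 => ->.
Qed.

Lemma T_idealP t : T_set I t <-> exists2 g, below t g & I (<< t >> + g).
Proof. exact/T_setP/I_subspace. Qed.

Lemma tlt_tdeg s t : tlt s t -> (tdeg s <= tdeg t)%N.
Proof.
rewrite /tlt /tdeg; case: (val s) (val t) => a ss [b ts]; rewrite ptltE.
by case/orP=> [/ltnW//|/andP[/eqP-> _]].
Qed.

(** If f in I has leading tree s, grafting f onto the tree r with root a and
    branches ts gives an element of I. Its leading tree is s grafted at the
    root of r: grafting at the root adds a branch, and the other trees u of f
    are replaced by smaller branches. *)
Lemma T_branch s a ts : all (@Defs.canonical d) ts ->
  T_set I s -> T_set I (mktree (PNode a (val s :: ts))).
Proof.
move=> cts /T_idealP[g bg Ig]; set t := mktree _; apply/T_idealP.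
pose r := mktree (PNode a ts).
have vr : val r = PNode a (sort (@ptle d) ts) by rewrite val_mktree_node.
have top u : mktree (PNode a (val u :: sort (@ptle d) ts)) =
             mktree (PNode a (val u :: ts)).
  by apply: mktree_same; apply: same_perm; rewrite perm_cons perm_sort.
have degm u : tdeg (mktree (PNode a (val u :: ts))) = (tdeg u + tdeg r)%N.
  by rewrite !tdeg_mktree !pdeg_node big_cons addnCA.
have graft_below u : (u == s) || tlt u s ->
    exists2 h, below t h &
      graft << u >> << r >> = << mktree (PNode a (val u :: ts)) >> + h.
  move=> us; have [h sh eh] := @graft_root K d u r a _ vr.
  rewrite {}top in eh; exists h; last exact: eh.
  move=> v /sh[dv wv]; have le_us : (tdeg u <= tdeg s)%N.
    by case/orP: us => [/eqP->//|]; apply: tlt_tdeg.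
  move: (leq_add le_us (leqnn (tdeg r))); rewrite -dv -degm leq_eqVlt.
  case/orP=> [/eqP e|]; last exact: tlt_deg.
  by apply: tlt_width => //; rewrite wv width_mktree /= size_sort.
have [h bh eh] : exists2 h, below t h & graft << s >> << r >> = << t >> + h.
  by apply: graft_below; rewrite eqxx.
exists (h + graft g << r >>); last first.
  have := I_graftl << r >> Ig; rewrite [graft _ _]bext_addl.
  by rewrite -/(graft _ _) -/(graft _ _) eh -addrA.
apply: (subspaceD (below_subspace t)) => //.
have -> : graft g << r >> = mext (fun u => graft << u >> << r >>) g.
  rewrite /Defs.graft /bext; congr (mext _ g).
  by apply/funext => u; rewrite !mextU.
apply: (subspace_mext (below_subspace t)) => u /bg us.
have [|k bk ->] := graft_below u; first by rewrite us orbT.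
apply: (subspaceD (below_subspace t)) => //; apply: supportedU.
have := tlt_tdeg us; rewrite leq_eqVlt => /orP[/eqP e|lt_us]; last first.
  by apply: tlt_deg; rewrite !degm ltn_add2r.
have cu (v : tree d) : all (@Defs.canonical d) (val v :: ts).
  by apply/andP; split=> //; apply: (valP v).
apply: tlt_lexlt => //.
  by rewrite !pdeg_node !big_cons; congr (_ + (_ + _))%N.
exact: lexlt_sort_cons.
Qed.

(** Let s be the least branch of t, and t' the rest of t. If s itself has two
    or more branches, [T_branch] applies. Otherwise consider the generator |s|
    (s -> t') + |t'| (t' -> s) of I. In s -> t' the largest tree is t, with s
    at the root. In t' -> s the largest tree is w, with t' at the root of s.
    It has fewer branches than t, or else both have two; then a branch of s,
    being of smaller degree, precedes s, hence both branches of t, so w is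
    smaller than t. *)
Lemma T_wide t : (1 < width t)%N -> T_set I t.
Proof.
elim/(well_founded_ind (@tlt_wf d)): t => t IH.
have [a [ts [vt so can et]]] := tree_node t; rewrite /width vt /=.
case: ts => [//|r ts] in vt so can et *; rewrite /= ltnS => ts0.
have /andP[cr cts] := can; have sts := path_sorted so.
pose s : tree d := exist (fun p => Defs.canonical p) r cr.
have [|le_w1] := ltnP 1 (width s).
  move=> /IH Ts; rewrite et; apply: (@T_branch s) => //; apply: Ts.
  apply: tlt_deg; rewrite /tdeg vt pdeg_node big_cons /= addnCA.
  by rewrite -[X in (X < _)%N]addn0 ltn_add2l.
have ct : Defs.canonical (PNode a ts) by apply/andP.
pose t' : tree d := exist (fun p => Defs.canonical p) (PNode a ts) ct.
have degt : tdeg t = (tdeg s + tdeg t')%N.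
  by rewrite /tdeg vt !pdeg_node big_cons addnCA.
have wt : width t = (size ts).+1 by rewrite /width vt.
have [g sg eg] := @graft_root K d s t' a ts erefl.
have bg : below t g.
  by move=> u /sg[du wu]; apply: tlt_width; [rewrite du | rewrite wu wt].
rewrite -et in eg.
case vs : (val s) le_w1 => [b rs]; rewrite /width vs /= => le_w1.
have [h sh eh] := @graft_root K d t' s b rs vs.
have bh : below t h.
  move=> u /sh[du wu]; apply: tlt_width; first by rewrite du addnC.
  by rewrite wu wt ltnS (leq_trans le_w1).
set w := mktree _ in eh.
have degw : tdeg w = tdeg t.
  rewrite tdeg_mktree pdeg_node big_cons addnCA degt addnC.
  by rewrite /tdeg vs pdeg_node.
have bw : tlt w t.
  have [lt_w|le_w] := ltnP (size rs) (size ts).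
    by apply: tlt_width => //; rewrite wt width_mktree.
  have szrs : size rs = size ts.
    by apply/eqP; rewrite eqn_leq le_w (leq_trans le_w1).
  have crs : all (@Defs.canonical d) rs.
    by have := canonical_branches s; rewrite vs.
  rewrite et; apply: tlt_lexlt => //; first by apply/andP; split.
  - by rewrite -tdeg_mktree -/w degw et tdeg_mktree.
  - by rewrite /= szrs.
  have [x xrs] : exists x, x \in rs.
    case: (rs) szrs => [e|x rs' _]; first by rewrite -e in ts0.
    by exists x; apply: mem_head.
  apply: (@lexlt_sort_min _ x); rewrite // ?inE ?xrs ?orbT //=.
  have xr : ptlt x r.
    apply: ptlt_deg; rewrite -[r]/(val s) vs pdeg_node (big_rem x) //=.
    by rewrite addnCA -[X in (X < _)%N]addn0 ltn_add2l.
  rewrite xr; move: so.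
  rewrite /= (path_sortedE (@ptle_trans d)) => /andP[rts _].
  apply: sub_all rts => y; rewrite /ptle => /orP[/eqP<-//|]; exact: ptlt_trans.
have s0 : (tdeg s)%:R != 0 :> K by apply/natr_neq0/tdeg_gt0.
apply/T_idealP.
exists (g + (tdeg s)%:R^-1 *: ((tdeg t')%:R *: graft << t' >> << s >>)).
  apply: (subspaceD (below_subspace t)) => //.
  do 2!apply: (subspaceZ (below_subspace t)).
  by rewrite eh; apply: (subspaceD (below_subspace t)) => //; apply: supportedU.
have := subspaceZ (@I_subspace K d) (tdeg s)%:R^-1 (@I_gen K d s t').
by rewrite (lead_regroup _ _ s0 eg).
Qed.

(** Trees outside T(I) have at most one branch at the root by [T_wide], and
    the branch is again outside T(I) by [T_branch]. *)
Lemma O_ladder t : O_set I t ->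
  (exists a, t = vertex a) \/
  exists s a, [/\ O_set I s, tlt s t & graft << s >> << vertex a >> = << t >>].
Proof.
move=> Ot; have [a [ts [vt so can et]]] := tree_node t.
case: ts => [|r [|r' ts]] in vt so can et.
- by left; exists a.
- right; have /andP[cr _] := can.
  pose s : tree d := exist (fun p => Defs.canonical p) r cr.
  exists s, a; split.
  + by move=> Ts; apply: Ot; rewrite et; apply: (@T_branch s).
  + apply: tlt_deg; rewrite /tdeg vt pdeg_node big_cons big_nil /= addn0.
    by rewrite -[X in (X < _)%N]add0n ltn_add2r.
  by rewrite graftUU /= big_seq1 et.
by case: Ot; apply: T_wide; rewrite /width vt.
Qed.

(** Division by the leading trees of I, which terminates because the order is
    well-founded. *)
Lemma normal_form f : exists2 g, supported (O_set I) g & I (f - g).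
Proof.
have sI := @I_subspace K d.
pose P f := exists2 g, supported (O_set I) g & I (f - g).
have sP : subspace P.
  split=> [|a f1 f2 [g1 O1 I1] [g2 O2 I2]].
    exists 0; first exact: (supported_subspace _ _).1.
    by rewrite subr0; apply: sI.1.
  exists (a *: g1 + g2); first exact: (supported_subspace _ _).2.
  by rewrite opprD addrACA -scalerBr; apply: sI.2.
apply: (malg_subspace sP) => t.
elim/(well_founded_ind (@tlt_wf d)): t => t IH.
have [/T_idealP[g bg Ig]|Ot] := pselect (T_set I t); last first.
  by exists << t >>; [apply: supportedU | rewrite subrr; apply: sI.1].
have [h Oh Ih] : P g.
  by rewrite [g]malg_mext; apply: (subspace_mext sP) => u /bg; apply: IH.
exists (- h); first exact: (subspaceN (supported_subspace _ _)).
rewrite opprK; have -> : << t >> + h = << t >> + g - (g - h).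
  by rewrite opprB addrA addrAC addrK.
exact: (subspaceB sI).
Qed.

Lemma leading_exists (f : tA) : f != 0 -> exists t, is_leading f t.
Proof.
have max_tree (l : seq (tree d)) : l != [::] ->
    exists2 t, t \in l & forall u, u \in l -> tle u t.
  elim: l => // x l IH _; have [->|/IH[t tl max]] := eqVneq l [::].
    exists x; rewrite ?mem_head // => u; rewrite inE => /eqP->.
    by rewrite tle_eqVlt eqxx.
  have [xt|tx] := boolP (tle x t).
    by exists t => [|u]; rewrite inE ?tl ?orbT // => /orP[/eqP->//|/max].
  have {}tx : tle t x.
    have /orP[|//] := ptle_total (val x) (val t).
    by rewrite -/(tle x t) (negbTE tx).
  exists x => [|u]; rewrite ?mem_head // inE => /orP[/eqP->|/max ut].
    by rewrite tle_eqVlt eqxx.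
  exact: ptle_trans ut tx.
move=> f0; have [|t tf max] := max_tree (msupp f).
  apply: contra f0 => /eqP f0; apply/eqP/malgP => x.
  rewrite mcoeff0 mcoeff_outdom //.
  by apply/negP => xf; have : x \in enum_fset (msupp f) by []; rewrite f0.
by exists t.
Qed.

Lemma O_independent f : I f -> supported (O_set I) f -> f = 0.
Proof.
move=> If Of; apply/eqP; apply: contraT => f0.
have [t lt] := leading_exists f0; case: (Of t lt.1); by exists f.
Qed.

End LeadingTrees.

(** * The monomial basis *)

Section Basis.
Variables (K : fieldType) (d : nat -> nat).
Hypothesis charK : [pchar K] =i pred0.

Notation tA := (treeAlg K d).
Notation I := (I_ideal K d).

Lemma mcoeff_lincomb (T X : choiceType) (s : seq T) (c : T -> K)
    (h : T -> X) x :
  uniq s -> {in s &, injective h} -> x \in s ->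
  (\sum_(y <- s) c y *: << h y >> : {malg K[X]})@_(h x) = c x.
Proof.
move=> us inj_h xs.
rewrite (big_morph (mcoeff (h x)) (mcoeffD (h x)) (mcoeff0 (h x))).
rewrite (bigD1_seq x) //= mcoeffZ mcoeffUU mulr1.
rewrite big_seq_cond big1 ?addr0 // => y /andP[ys yx].
rewrite mcoeffZ mcoeffU; case: eqVneq => [|_]; last by rewrite mulr0.
by move/(inj_h _ _ ys xs) => e; rewrite e eqxx in yx.
Qed.

(** Several x in X may have the same image under h; the coefficient of a
    vector collects all of them. *)
Lemma spanning_image (V : lmodType K) (X : choiceType) (P : X -> Prop)
    (h : X -> V) (g : {malg K[X]}) :
  supported P g -> exists (s : seq V) (c : V -> K),
    (forall x, x \in s -> exists2 t, P t & h t = x) /\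
    mext h g = \sum_(x <- s) c x *: x.
Proof.
move=> Pg; exists (undup [seq h t | t <- msupp g]).
exists (fun x => \sum_(t <- msupp g | h t == x) g@_t); split=> [x|].
  by rewrite mem_undup => /mapP[t /Pg Pt ->]; exists t.
under eq_bigr do rewrite scaler_suml big_mkcond.
rewrite exchange_big /= mext_def big_seq [RHS]big_seq; apply: eq_bigr => t tg.
rewrite (bigD1_seq (h t)) ?undup_uniq ?mem_undup ?map_f //= eqxx.
rewrite big1 ?addr0 // => x.
by rewrite eq_sym => /negbTE->.
Qed.

Variable Phi : {linear tA -> freeLie K d}.
Hypothesis Phi_prelie : forall f g : tA, Phi (graft f g) = rhd (Phi f) (Phi g).
Hypothesis Phi_gen : forall a : gen d, Phi << vertex a >> = lgen K a.

(** A tree outside T(I) is a ladder; Phi sends it to the bracket of its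
    decorations, nested to the left, divided by the degrees of the proper
    subladders. *)
Lemma Phi_monomial t : O_set I t ->
  exists (c : K) (w : magma d), c != 0 /\ Phi << t >> = c *: lmonomial K w.
Proof.
elim/(well_founded_ind (@tlt_wf d)): t => t IH Ot.
have [[a ->]|[s [a [Os lt_st <-]]]] := O_ladder charK Ot.
  by exists 1, (Gen a); rewrite oner_neq0 scale1r Phi_gen.
have [c [w [c0 ew]]] := IH s lt_st Os.
have s0 : ((tdeg s)%:R : K) != 0 by apply/(natr_neq0 charK)/tdeg_gt0.
exists ((tdeg s)%:R^-1 * c), (Br w (Gen a)); split.
  by rewrite mulf_neq0 ?invr_neq0.
have [[bl _] _ _] := lbr_lie K d.
rewrite (Phi_graft charK Phi_prelie Phi_gen) Phi_gen ew -scalerA.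
by rewrite (linear_mapZ _ _ (bl (lgen K a))).
Qed.

End Basis.

Theorem corollary22 (K : fieldType) (d : nat -> nat)
  (charK : [pchar K] =i pred0)
  (E_nonempty : exists n, (0 < d n)%N)
  (Phi : {linear treeAlg K d -> freeLie K d})
  (Phi_prelie : forall f g : treeAlg K d,
     Phi (graft f g) = rhd (Phi f) (Phi g))
  (Phi_gen : forall a : gen d, Phi << vertex a >> = lgen K a) :
  monomial_basis [set Phi << t >> | t in O_set (I_ideal K d)]%classic.
Proof.
have ker := Phi_ker charK Phi_prelie Phi_gen.
split; last by move=> _ [t Ot <-]; apply: Phi_monomial Ot.
split=> [s c us sB sum0|v]; last first.
  have [f <-] := Phi_onto charK Phi_prelie Phi_gen v.
  have [g Og /ker/eqP] := normal_form f.
  rewrite linearB subr_eq0 => /eqP->.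
  by rewrite linear_mext; apply: spanning_image.
have [n dn] := E_nonempty.
pose t0 : tree d := vertex (Tagged (fun n => 'I_(d n)) (Ordinal dn)).
have /choice[h hP] : forall x, exists t,
    x \in s -> O_set (I_ideal K d) t /\ Phi << t >> = x.
  move=> x; have [/sB[t Ot <-]|_] := boolP (x \in s); last by exists t0.
  by exists t.
pose f : treeAlg K d := \sum_(x <- s) c x *: << h x >>.
have f0 : f = 0.
  apply: O_independent.
    apply/ker; rewrite linear_sum -[RHS]sum0 !big_seq; apply: eq_bigr => x xs.
    by rewrite linearZ /= (hP x xs).2.
  apply: subspace_sum => [|x xs]; first exact: supported_subspace.
  apply: (subspaceZ (supported_subspace _ _)); apply: supportedU.
  exact: (hP x xs).1.
have inj_h : {in s &, injective h}.
  by move=> x y xs ys e; rewrite -(hP x xs).2 -(hP y ys).2 e.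
by move=> x xs; rewrite -(mcoeff_lincomb c us inj_h xs) -/f f0 mcoeff0.
Qed.
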